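(* Let $I=[0,1]$ and $\mathbb{R}_+=[0,\infty)$. Assume: - $k_1,k_2:I^2\to\mathbb{R}_+$ are continuous; - there exist an interval $[a,b]\subset I$, a function $\Phi_1:I\to\mathbb{R}_+$, $\Phi_1\in L^1(I)$, and a constant $c_1\in(0,1]$ such that $k_1(t,s)\le\Phi_1(s)$ for all $t,s\in I$ and $c_1\Phi_1(s)\le k_1(t,s)$ for all $t\in[a,b]$, $s\in I$; - there exist a function $\Phi_2:I\to\mathbb{R}_+$, $\Phi_2\in L^1(I)$, and a constant $c_2\in(0,1]$ such that $c_2\Phi_2(s)\le k_2(t,s)\le\Phi_2(s)$ for all $t,s\in I$; - $f,g:I\times\mathbb{R}_+^2\to\mathbb{R}_+$ are continuous. Suppose that there exist $\rho_1,\rho_2>0$ and $0<\alpha<\beta$ such that either (Case A) $\rho_1/c_1<\rho_2$, or (Case B) $\rho_2<\rho_1$, and such that: (i) there is a continuous function $\underline{f}:I\to\mathbb{R}_+$ with $\underline{f}(t)\le f(t,u,v)$ on $[a,b]\times[\rho_1,\rho_1/c_1]\times[\alpha,\beta]$ and $\min_{t\in[a,b]}\int_a^b k_1(t,s)\underline{f}(s)\,ds\ge\rho_1$; (ii) there is a continuous function $\overline{f}:I\to\mathbb{R}_+$ with $f(t,u,v)\le\overline{f}(t)$ on $[0,1]\times[0,\rho_2]\times[\alpha,\beta]$ and $\max_{t\in[0,1]}\int_0^1 k_1(t,s)\overline{f}(s)\,ds\le\rho_2$; (iii) there is a continuous function $\underline{g}:I\to\mathbb{R}_+$ with $\underline{g}(t)\le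 g(t,u,v)$ on $[a,b]\times[\rho_1,\rho_2]\times[\alpha,\beta]$ in Case A (respectively, on $[a,b]\times[c_1\rho_2,\rho_1/c_1]\times[\alpha,\beta]$ in Case B) and $\min_{t\in[0,1]}\int_a^b k_2(t,s)\underline{g}(s)\,ds\ge\alpha$; (iv) there is a continuous function $\overline{g}:I\to\mathbb{R}_+$ with $g(t,u,v)\le\overline{g}(t)$ on $[0,1]\times[0,\rho_2]\times[\alpha,\beta]$ in Case A (respectively, on $[0,1]\times[0,\rho_1/c_1]\times[\alpha,\beta]$ in Case B) and $\max_{t\in[0,1]}\int_0^1 k_2(t,s)\overline{g}(s)\,ds\le\beta$. Then the system $$u(t)=\int_0^1 k_1(t,s)f(s,u(s),v(s))\,ds,\qquad v(t)=\int_0^1 k_2(t,s)g(s,u(s),v(s))\,ds,\qquad t\in I,$$ has at least one positive solution $(u,v)\in K=K_1\times K_2$ such that $\alpha\le v(t)\le\beta$ for all $t\in I$ and, in Case A, $\rho_1\le\min_{t\in[a,b]}u(t)$ and $\|u\|_\infty\le\rho_2$ (respectively, in Case B, $\rho_2\le\|u\|_\infty$ and $\min_{t\in[a,b]}u(t)\le\rho_1$).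
   Context: $\mathcal{C}(I)$ is the Banach space of continuous real functions on $I=[0,1]$ with $\|w\|_\infty=\max_{t\in I}|w(t)|$. The cones are $$K_1=\{w\in\mathcal{C}(I): w(t)\ge0\ \text{for all }t\in I,\ \min_{t\in[a,b]}w(t)\ge c_1\|w\|_\infty\},$$ $$K_2=\{w\in\mathcal{C}(I):\min_{t\in[0,1]}w(t)\ge c_2\|w\|_\infty\},$$ and $K=K_1\times K_2$. A positive solution is a pair of continuous functions in $K$ satisfying the system, both components being nonnegative and not identically zero. *)

(* Defs.v *)
From HB Require Import structures.
From mathcomp Require Import all_boot all_order all_algebra.
From mathcomp Require Import all_classical all_reals all_analysis.

Set Implicit Arguments.
Unset Strict Implicit.
Unset Printing Implicit Defensive.

Import Order.TTheory GRing.Theory Num.Theory.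
Import numFieldNormedType.Exports.

Local Open Scope classical_set_scope.
Local Open Scope ring_scope.

(* Functions on a subset D of a type T are represented by total functions on T;
   everything below depends only on their values on D. *)

Definition unitI (R : realType) : set R := `[0, 1].

Definition Rplus (R : realType) : set R := `[0, +oo[.

Definition continuous_nneg_on (R : realType) (T : topologicalType)
    (D : set T) (w : T -> R) : Prop :=
  {within D, continuous w} /\ (forall x, D x -> 0 <= w x).

(* These are only applied to continuous functions on nonempty compact
   intervals, where the supremum and the infimum are attained. *)
Definition max_on (R : realType) (D : set R) (w : R -> R) : R :=
  sup [set w t | t in D].

Definition min_on (R : realType) (D : set R) (w : R -> R) : R :=
  inf [set w t | t in D].

Definition norm_oo (R : realType) (w : R -> R) : R :=
  max_on (@unitI R) (fun t => `|w t|).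

Definition cone1 (R : realType) (a b c1 : R) : set (R -> R) :=
  [set w : R -> R | [/\ {within @unitI R, continuous w},
               forall t, unitI t -> 0 <= w t &
               c1 * norm_oo w <= min_on `[a, b] w]].

Definition cone2 (R : realType) (c2 : R) : set (R -> R) :=
  [set w : R -> R | {within @unitI R, continuous w} /\
           c2 * norm_oo w <= min_on (@unitI R) w].

Definition coneK (R : realType) (a b c1 c2 : R) : set ((R -> R) * (R -> R)) :=
  cone1 a b c1 `*` cone2 c2.

Definition solves_system (R : realType) (k1 k2 : R * R -> R)
    (f g : R * R * R -> R) (u v : R -> R) : Prop :=
  forall t, unitI t ->
    u t = \int[@lebesgue_measure R]_(s in @unitI R)
            (k1 (t, s) * f (s, u s, v s)) /\
    v t = \int[@lebesgue_measure R]_(s in @unitI R)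
            (k2 (t, s) * g (s, u s, v s)).

Definition nneg_nonzero (R : realType) (w : R -> R) : Prop :=
  (forall t, unitI t -> 0 <= w t) /\ (exists2 t, unitI t & w t != 0).

Definition positive_solution (R : realType) (a b c1 c2 : R)
    (k1 k2 : R * R -> R) (f g : R * R * R -> R) (u v : R -> R) : Prop :=
  [/\ coneK a b c1 c2 (u, v), solves_system k1 k2 f g u v,
      nneg_nonzero u & nneg_nonzero v].

(* Main.v *)
(* With y = T1(u, v), a solution is sought in the form u = s w, where w lies in
   the convex slice w(a) = 1 of the cone K1 and, tau being a further unknown in
   [0, 1],
     s = (1 - tau) rho2 / ||w|| + tau rho1 / min_[a, b] w.
   With d = max(0, s - y(a)), consider the map
     w <- (y + d) / (y(a) + d),  tau <- clamp(tau + s - y(a)),  v <- T2(u, v).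
   It sends a compact convex set of equicontinuous functions into itself and is
   uniformly continuous there. At a fixed point u = y: this is clear if
   s = y(a); if s > y(a) then tau = 1, so min u = rho1 <= min y by (i), whereas
   u = y + d with d > 0; if s < y(a) then tau = 0, so ||u|| = rho2 >= ||y|| by
   (ii), whereas u = (s / y(a)) y. The two cases of the theorem differ only in
   the order of the two radii rho2 / ||w|| and rho1 / min_[a, b] w, so that no
   fixed point index is needed.

   Schauder's theorem is obtained from Scarf's combinatorial lemma, which plays
   the role of Sperner's lemma: a point t of a fine grid of the simplex spanned
   by a finite net y_i is coloured by an i such that S(sum_j t_j y_j) is close to
   y_i. A rainbow dominating family is concentrated near one point, carried up to
   a small error by its colours, and that point is almost fixed. *)
Require Import Defs.
From HB Require Import structures.
From mathcomp Require Import all_boot all_order all_algebra.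
From mathcomp Require Import all_classical all_reals all_analysis.
From mathcomp Require Import ring lra.

Set Implicit Arguments.
Unset Strict Implicit.
Unset Printing Implicit Defensive.

Import Order.TTheory GRing.Theory Num.Theory.
Import numFieldNormedType.Exports.

Local Open Scope classical_set_scope.
Local Open Scope ring_scope.

(** * Scarf's lemma *)

(* The elements [e i] are Scarf's slack vectors: [e i] is minimal for the order
   [r i] and above all ordinary vertices for the other orders. The existence of
   a room carrying all colours is a parity argument: every room without all the
   colours has 0 or 2 doors, every other one has one, and a door belongs to two
   rooms or to none, except for the single door made of slack vectors, which
   belongs to one. *)
Section Scarf.
Local Open Scope nat_scope.
Variables (I V : finType) (r : I -> V -> nat) (c : V -> I) (e : I -> V).
Hypothesis r_inj : forall i, injective (r i).
Hypothesis ceK : cancel e c.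
Hypothesis r_own_slack : forall i y, r i (e i) <= r i y.
Hypothesis r_slack : forall i j y, j != i -> y \notin codom e ->
  r i y < r i (e j).

(** Scarf's primitive sets: no vertex lies strictly above the minimum of [X] in all the orders at
    once. *)
Definition dominating (X : {set V}) : Prop :=
  forall y, exists i, forall x, x \in X -> r i y <= r i x.

Let room (X : {set V}) : bool := (#|X| == #|I|) && `[< dominating X >].

Lemma dominatingS (X Y : {set V}) :
  Y \subset X -> dominating X -> dominating Y.
Proof.
move=> /fintype.subsetP YX dX y; have [i iP] := dX y.
by exists i => x /YX; exact: iP.
Qed.

Variable i0 : I.

Let door (Y : {set V}) : bool :=
  (#|Y| == #|I|.-1) && (c @: Y == [set~ i0])%SET.

Let cardI_gt0 : 0 < #|I|.
Proof. by apply/card_gt0P; exists i0. Qed.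

Lemma door_inj (Y : {set V}) : door Y -> {in Y &, injective c}.
Proof.
move=> /andP[/eqP cY /eqP iY]; apply/imset_injP.
by rewrite iY cY cardsC1.
Qed.

(** Once [X :\ x] is a door, [c] is injective on it, so [X :\ z] is a door exactly when [c z = c x].
    If [c x = i0], only [x] qualifies and all colours occur; otherwise exactly one other vertex
    shares the colour of [x], and [i0] is missing. Conversely, a set with all colours has a door,
    got by removing its vertex of colour [i0]. *)
Lemma odd_doors_of_room (X : {set V}) : #|X| = #|I| ->
  \big[addb/false]_(x in X) door (X :\ x) = [forall i, i \in c @: X].
Proof.
move=> cX.
have dX x : x \in X -> #|X :\ x| = #|I|.-1.
  by move=> xX; rewrite -cX (cardsD1 x X) xX.
have [/existsP[x /andP[xX dx]]|/existsPn nd] :=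
    boolP [exists x, (x \in X) && door (X :\ x)]; last first.
  rewrite big1; last by move=> x xX; have := nd x; rewrite xX => /negbTE.
  apply/esym/negbTE/negP => /forallP cXT.
  have /imsetP[x xX cx] := cXT i0.
  have cinj : {in X &, injective c}.
    apply/imset_injP; rewrite cX.
    suff -> : (c @: X = [set: I])%SET by rewrite cardsT.
    by apply/setP => i; rewrite cXT inE.
  have := nd x; rewrite xX/= /door dX// eqxx/= => /negP; apply; apply/eqP/setP => i.
  rewrite !inE; apply/imsetP/idP => [[z]|ni].
    rewrite !inE => /andP[zx zX] ->; apply: contra zx => /eqP cz.
    by apply/eqP/cinj => //; rewrite cz.
  have /imsetP[z zX iz] := cXT i; exists z => //; rewrite !inE zX andbT.
  by apply: contra ni => /eqP zx; rewrite iz zx cx.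
have cinj := door_inj dx; have /andP[_ /eqP imx] := dx.
have doorE z : z \in X -> door (X :\ z) = (c z == c x).
  move=> zX; have [->|zx] := eqVneq z x; first by rewrite dx eqxx.
  apply/idP/eqP => [dz|czx].
    apply/eqP/negPn/negP => czx.
    have : c z \in (c @: (X :\ x))%SET by apply: imset_f; rewrite !inE zx.
    rewrite imx !inE => cz0; have /andP[_ /eqP imz] := dz.
    have : c z \in [set~ i0]%SET by rewrite !inE.
    rewrite -imz => /imsetP[z']; rewrite !inE => /andP[z'z z'X] czz'.
    have z'x : z' != x by apply: contra czx => /eqP <-; rewrite czz'.
    by move/eqP: z'z; apply; apply: cinj => //; rewrite !inE ?z'x ?zx.
  rewrite /door dX// eqxx/= -imx; apply/eqP/setP => i; apply/imsetP/imsetP.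
    move=> [y]; rewrite !inE => /andP[yz yX] ->.
    have [->|yx] := eqVneq y x; last by exists y => //; rewrite !inE yx.
    by exists z => //; rewrite !inE zx.
  move=> [y]; rewrite !inE => /andP[yx yX] ->.
  have [->|yz] := eqVneq y z; last by exists y => //; rewrite !inE yz.
  by exists x => //; rewrite !inE eq_sym zx.
rewrite (eq_bigr (fun z => c z == c x)); last by move=> z; exact: doorE.
rewrite (bigD1 x)//= eqxx.
have [cx|cx] := eqVneq (c x) i0.
  rewrite big1; last first.
    move=> z /andP[zX zx]; apply/negbTE; rewrite cx.
    have : c z \in (c @: (X :\ x))%SET by apply: imset_f; rewrite !inE zx.
    by rewrite imx !inE.
  apply/esym/forallP => i; have [->|ii0] := eqVneq i i0.
    by rewrite -cx; exact: imset_f.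
  have : i \in [set~ i0]%SET by rewrite !inE.
  rewrite -imx => /imsetP[z]; rewrite !inE => /andP[_ zX] ->.
  exact: imset_f.
have : c x \in [set~ i0]%SET by rewrite !inE.
rewrite -imx => /imsetP[z]; rewrite !inE => /andP[zx zX] czx.
rewrite (bigD1 z)/=; last by rewrite zX.
rewrite czx eqxx big1 => [|y /andP[/andP[yX yx] yz]]; last first.
  apply: contraNF yz => /eqP cyz.
  by apply/eqP; apply: cinj => //; rewrite !inE ?yx ?zx.
apply/esym/negbTE/negP => /forallP /(_ i0) /imsetP[y yX cy].
have yx : y != x by apply: contraNneq cx => <-; rewrite -cy.
have : c y \in (c @: (X :\ x))%SET by apply: imset_f; rewrite !inE yx.
by rewrite imx !inE -cy eqxx.
Qed.

Let outer : {set V} := (e @: [set~ i0])%SET.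

Lemma outer_door : door outer.
Proof.
apply/andP; split.
  by rewrite card_imset ?cardsC1//; exact: can_inj ceK.
rewrite -imset_comp; apply/eqP/setP => i; apply/imsetP/idP.
  by move=> [j jP ->] /=; rewrite ceK.
by move=> iP; exists i => //=; rewrite ceK.
Qed.

Lemma room_add (Y : {set V}) x : #|Y| = #|I|.-1 -> x \notin Y ->
  room (x |: Y) = `[< dominating (x |: Y) >].
Proof. by move=> cY xY; rewrite /room cardsU1 xY cY add1n prednK// eqxx. Qed.

(** The only completion is by the [r i0]-largest vertex [m] outside [outer]. Any other [x] leaves
    [m] undominated: [m] is above [x] for [r i0], and above the slack vector [e i] for every other
    [r i]. *)
Lemma odd_rooms_of_outer :
  \big[addb/false]_(x | x \notin outer) room (x |: outer).
Proof.
have /andP[/eqP co _] := outer_door.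
have e0 : e i0 \notin outer.
  apply/imsetP => -[j]; rewrite !inE => ji0 /(can_inj ceK) ij.
  by rewrite ij eqxx in ji0.
case: (@arg_maxnP _ (e i0) (fun y => y \notin outer) (r i0) e0) => m mo mmax.
rewrite (bigD1 m)//= big1 => [|x /andP[xo xm]].
  rewrite addbF room_add//; apply/asboolP => y.
  have [/imsetP[j]|yo] := boolP (y \in outer).
    by rewrite !inE => ji0 ->; exists j => x _; exact: r_own_slack.
  exists i0 => x /setU1P[->|/imsetP[j]]; first exact: mmax.
  rewrite !inE => ji0 ->.
  have [/codomP[k yk]|ye] := boolP (y \in codom e).
    suff -> : y = e i0 by exact: r_own_slack.
    rewrite yk; congr e; apply/eqP; apply: contraNT yo => ki0.
    by rewrite yk; apply: imset_f; rewrite !inE.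
  exact/ltnW/r_slack.
rewrite room_add//; apply/asboolP => /(_ m)[i iP].
have [ii0|ii0] := eqVneq i i0.
  move/eqP: xm; apply; apply: (r_inj (i := i0)); apply/eqP.
  by rewrite eqn_leq -{3}ii0 -{3}ii0 iP ?inE ?eqxx// andbT; exact: mmax.
have eio : e i \in outer by apply: imset_f; rewrite !inE.
move/negP: mo; apply; suff -> : m = e i by [].
apply: (r_inj (i := i)); apply/eqP.
by rewrite eqn_leq r_own_slack iP// !inE eio orbT.
Qed.

(** [Y] has one vertex fewer than there are orders, so two orders [i], [j] share their minimum on
    [Y]. A new vertex must become the minimum for one of them, [k], while staying above the old
    minima for all the other orders, and must be [r k]-largest among such vertices. This leaves
    exactly the two choices [X i] and [X j]. *)
Lemma odd_rooms_of_inner (Y : {set V}) : door Y -> Y != outer ->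
  \big[addb/false]_(x | x \notin Y) room (x |: Y) = false.
Proof.
move=> dY Yo; have /andP[/eqP cY /eqP imY] := dY.
have [/existsP[x0 /andP[x0Y rx0]]|/existsPn nr] :=
    boolP [exists x, (x \notin Y) && room (x |: Y)]; last first.
  by rewrite big1// => x xY; have := nr x; rewrite xY => /negbTE.
have domY : dominating Y.
  move: rx0; rewrite room_add// => /asboolP; apply: dominatingS.
  exact: finset.subsetUr.
(* Since [c (e i) = i], the only door made of slack vectors alone is [outer]. *)
have [y0 y0Y y0e] : exists2 y0, y0 \in Y & y0 \notin codom e.
  apply/exists_inP; apply: contraNT Yo => /exists_inPn Ye.
  apply/eqP/setP => y; apply/idP/imsetP => [yY|[i]].
    have := Ye _ yY; rewrite negbK => /codomP[i yi]; exists i => //.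
    by rewrite -imY; apply/imsetP; exists y => //; rewrite yi ceK.
  rewrite -imY => /imsetP[y' y'Y ->] ->.
  by have := Ye _ y'Y; rewrite negbK => /codomP[k y'k]; rewrite y'k ceK -y'k.
pose m i := [arg min_(x < y0 in Y) r i x].
have mP i : m i \in Y /\ forall x, x \in Y -> r i (m i) <= r i x.
  by rewrite /m; case: arg_minnP => // x.
have mE i y : y \in Y -> (forall x, x \in Y -> r i y <= r i x) -> y = m i.
  move=> yY yP; apply: (r_inj (i := i)); apply/eqP; rewrite eqn_leq.
  by rewrite yP ?(mP i).1// (mP i).2.
(* Pigeonhole: there are more orders than vertices in [Y]. *)
have [i [j [ij mij]]] : exists i j, i != j /\ m i = m j.
  have : ~~ injectiveb m.
    apply/negP => /injectiveP minj.
    have : #|(m @: [set: I])%SET| <= #|Y|.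
      by apply/subset_leq_card/fintype.subsetP => _ /imsetP[k _ ->]; exact: (mP k).1.
    by rewrite card_imset// cardsT cY -ltnS prednK// ltnn.
  by case/injectivePn => i [j ij mij]; exists i, j.
pose M k : pred V := fun y => [forall l, (l != k) ==> (r l (m l) < r l y)].
have MP k y : reflect (forall l, l != k -> r l (m l) < r l y) (M k y).
  by apply: (iffP forall_inP).
(* This makes the maximum [X k] range over a nonempty set. The ordinary vertex [y0] is below every
   foreign slack vector, so a slack vector that is [r l]-minimal on [Y] can only be [e l]. *)
have Me k : M k (e k).
  apply/MP => l lk.
  have [/codomP[l' ml']|me] := boolP (m l \in codom e); last first.
    by apply: r_slack => //; rewrite eq_sym.
  have ll' : l' = l.
    apply/eqP/negPn/negP => l'l; have := r_slack l'l y0e.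
    by rewrite -ml' ltnNge (mP l).2.
  rewrite ltn_neqAle; apply/andP; split; last first.
    by rewrite ml' ll'; exact: r_own_slack.
  apply/eqP => /r_inj; rewrite ml' ll' => /(can_inj ceK) lk'.
  by rewrite lk' eqxx in lk.
pose X k := [arg max_(x > e k | M k x) r k x].
have XP k : M k (X k) /\ forall y, M k y -> r k y <= r k (X k).
  by rewrite /X; case: arg_maxnP => //.
(* By domination each vertex of [Y] is the minimum for some order, and because [m i = m j] that
   order can be taken different from [k]. *)
have MnY k y : k = i \/ k = j -> M k y -> y \notin Y.
  move=> kij /MP yM; apply/negP => yY.
  have [l lP] := domY y.
  have [l' l'k yl'] : exists2 l', l' != k & y = m l'.
    have ym := mE _ _ yY lP.
    have [lk|lk] := eqVneq l k; last by exists l.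
    case: kij => kE.
      by exists j; [rewrite kE eq_sym|rewrite ym lk kE].
    by exists i; [rewrite kE|rewrite ym lk kE].
  by have := yM _ l'k; rewrite yl' ltnn.
have Xij : X i != X j.
  apply/eqP => XE; have [l lP] := domY (X i).
  have := lP _ (mP l).1; apply/negP; rewrite -ltnNge.
  have [li|li] := eqVneq l i; last by have /MP := (XP i).1; apply.
  by rewrite XE; have /MP := (XP j).1; apply; rewrite li.
have Xroom k : k = i \/ k = j -> room (X k |: Y).
  move=> kij; rewrite room_add ?(MnY k)//; last exact: (XP k).1.
  apply/asboolP => y.
  have [yM|/forall_inPn[l lk]] := boolP (M k y).
    exists k => x /setU1P[->|xY]; first exact: (XP k).2.
    have [l lP] := domY y; suff <- : l = k by exact: lP.
    apply/eqP/negPn/negP => lk.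
    by have /MP/(_ _ lk) := yM; rewrite ltnNge lP// (mP l).1.
  rewrite -leqNgt => yl; exists l => x /setU1P[->|xY].
    by apply: leq_trans yl (ltnW _); have /MP := (XP k).1; apply.
  exact: leq_trans yl ((mP l).2 _ xY).
(* In a room each vertex [z] is minimal for some order [l z]. On [Y] these orders are distinct and
   miss a single [k]; as [m i = m j], they cannot include both [i] and [j], so [k] is one of the
   two. Domination of [X k] must then occur in the order [k], which gives [x = X k]. *)
have roomX x : x \notin Y -> room (x |: Y) -> x = X i \/ x = X j.
  move=> xY; rewrite room_add// => /asboolP dx.
  have [l lP] := fin_all_exists dx.
  have ml z : z \in Y -> m (l z) = z.
    by move=> zY; apply/esym/mE => // y yY; apply: lP; rewrite inE yY orbT.
  have linj : {in Y &, injective l}.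
    by move=> z z' zY z'Y lzz'; rewrite -(ml z)// -(ml z')// lzz'.
  have [k kE] : exists k, (~: (l @: Y) = [set k])%SET.
    apply/cards1P; have := cardsC (l @: Y); rewrite card_in_imset// cY.
    by rewrite -[X in _ = X -> _](prednK cardI_gt0) -addn1 => /addnI ->.
  have lk l' : l' != k -> exists2 z, z \in Y & l' = l z.
    move=> l'k; apply/imsetP; apply: contraR l'k => nl'.
    by rewrite -finset.in_set1 -kE finset.in_setC.
  have xM : M k x.
    apply/MP => l' /lk[z zY ->]; rewrite ml// ltn_neqAle lP ?inE ?eqxx// andbT.
    by apply: contraNneq xY => /r_inj <-.
  have kij : k = i \/ k = j.
    have [->|ki] := eqVneq k i; first by left.
    have [->|kj] := eqVneq k j; first by right.
    have [|z zY iz] := lk i; first by rewrite eq_sym.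
    have [|z' z'Y jz'] := lk j; first by rewrite eq_sym.
    move: mij ij; rewrite iz jz' !ml// => -> /eqP; contradiction.
  suff -> : x = X k by case: kij => ->; [left|right].
  apply: (r_inj (i := k)); apply/eqP; rewrite eqn_leq (XP k).2//=.
  have lX : l (X k) = k.
    apply/eqP/negPn/negP => lXk.
    have /MP/(_ _ lXk) := (XP k).1; rewrite ltnNge lP//.
    by rewrite inE (mP _).1 orbT.
  by have := lP (X k) x; rewrite lX; apply; exact: finset.setU11.
rewrite (bigD1 (X i))/=; last by apply: (MnY i); [left|exact: (XP i).1].
rewrite (bigD1 (X j))/=; last first.
  by rewrite eq_sym Xij andbT; apply: (MnY j); [right|exact: (XP j).1].
rewrite !Xroom//=; [|by right|by left].
rewrite big1// => x /andP[/andP[xY xi] xj]; apply/negbTE/negP => /(roomX _ xY).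
by case=> xE; rewrite xE eqxx in xi xj.
Qed.

Lemma exists_rainbow_dominating :
  exists2 X : {set V}, dominating X & forall i, exists2 x, x \in X & c x = i.
Proof.
suff : \big[addb/false]_(X | room X) [forall i, i \in c @: X].
  move=> total.
  have [/existsP[X /andP[/andP[_ /asboolP dX] /forallP cX]]|/existsPn nX] :=
      boolP [exists X, room X && [forall i, i \in c @: X]].
    by exists X => // i; have /imsetP[x xX ->] := cX i; exists x.
  by move: total; rewrite big1// => X rX; have := nX X; rewrite rX => /negbTE.
(* Double counting modulo 2 of the pairs formed by a room and a vertex whose removal leaves a
   door. *)
under eq_bigr => X /andP[/eqP cX _] do rewrite -odd_doors_of_room//.
(* Toggling [x] reindexes the rooms that contain [x] by what remains of them without [x], so that
   the sum can be taken over doors first. *)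
have toggleK x : involutive (fun X : {set V} => if x \in X then X :\ x else x |: X).
  move=> X /=; have [xX|xX] := boolP (x \in X).
    by rewrite setD11 finset.setD1K.
  by rewrite finset.setU11 finset.setU1K.
rewrite (exchange_big_dep predT)//=.
under eq_bigr => x _.
  rewrite (reindex_inj (inv_inj (toggleK x)))/=.
  rewrite (eq_bigl (fun Y : {set V} => (x \notin Y) && room (x |: Y))); last first.
    by move=> Y; case: (boolP (x \in Y)) => xY; rewrite !inE ?eqxx//= andbC.
  under eq_bigr => Y /andP[/negbTE xY _] do rewrite xY finset.setU1K ?xY//.
  over.
rewrite (exchange_big_dep predT)//=.
rewrite (bigD1 outer)//= [X in _ (+) X]big1 => [|Y Yo].
  rewrite addbF; apply: etrans odd_rooms_of_outer.
  rewrite big_mkcondr/=; apply: eq_bigr => x _.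
  by rewrite outer_door; case: room.
have [dY|ndY] := boolP (door Y); last by rewrite big1.
rewrite -[RHS](odd_rooms_of_inner dY Yo) [RHS]big_mkcond/= big_mkcond/=.
by apply: eq_bigr => x _; case: (x \notin Y) => //=; case: room.
Qed.

End Scarf.

(** * Scarf's lemma on the integer grid of a simplex *)

Section GridRainbow.
Local Open Scope nat_scope.
Variables (I : finType) (i0 : I) (m : nat) (c : (I -> nat) -> I).

Let T : finType := {t : {ffun I -> 'I_m.+1} | \sum_i t i == m}.

Let coord (t : T) (i : I) : nat := (val t) i.

Let sum_coord t : \sum_i coord t i = m.
Proof. exact/eqP/(valP t). Qed.

Let mk_point (y : I -> nat) : \sum_i y i = m -> exists t, coord t =1 y.
Proof.
move=> ym.
have ylt i : y i < m.+1 by rewrite ltnS -ym (bigD1 i)//= leq_addr.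
have tP : \sum_i [ffun i => Ordinal (ylt i)] i == m.
  by rewrite -[X in _ == X]ym; apply/eqP/eq_bigr => i _; rewrite ffunE.
exists (exist (fun t : {ffun I -> 'I_m.+1} => \sum_i t i == m) _ tP).
by move=> i; rewrite /coord/= ffunE.
Qed.

(** Order [i] compares the [i]-th coordinates, and [enum_rank] breaks ties to make it injective. The
    slack vector of index [i] has the least rank 0; the others rank above all grid points, whose
    coordinates are at most [m]. *)
Let rk (i : I) (v : T + I) : nat :=
  match v with
  | inl t => (coord t i * #|T| + enum_rank t).+1
  | inr j => if i == j then 0 else (m.+1 * #|T| + enum_rank j).+1
  end.

Let rk_lt i t : rk i (inl t) < (m.+1 * #|T|).+1.
Proof.
rewrite /= ltnS; apply: (@leq_trans ((coord t i).+1 * #|T|)).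
  by rewrite mulSn addnC ltn_add2r; exact: ltn_ord.
by rewrite leq_mul2r ltn_ord orbT.
Qed.

Let rk_inj i : injective (rk i).
Proof.
case=> [t|j] [t'|j'].
- move=> /eqP; rewrite eqSS => /eqP /(congr1 (modn^~ #|T|)).
  by rewrite !modnMDl !modn_small// => /ord_inj/enum_rank_inj ->.
- have := rk_lt i t => /=; case: eqP => // _ /[swap] ->.
  by rewrite ltnS ltnNge leq_addr.
- have := rk_lt i t' => /=; case: eqP => // _ /[swap] <-.
  by rewrite ltnS ltnNge leq_addr.
- rewrite /=; case: eqP => [<-|_]; case: eqP => [<-|_]//.
  by move=> /eqP; rewrite eqSS eqn_add2l => /eqP/ord_inj/enum_rank_inj ->.
Qed.

Let rk_le i t t' : rk i (inl t) <= rk i (inl t') -> coord t i <= coord t' i.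
Proof.
rewrite /= ltnS; apply: contraTT; rewrite -!ltnNge => lt_t't.
apply: leq_trans (leq_addr _ _).
apply: leq_trans (_ : (coord t' i).+1 * #|T| <= _); last by rewrite leq_mul2r lt_t't orbT.
by rewrite mulSn addnC ltn_add2r.
Qed.

(* Dominance bounds the total of the lower bounds [l] from below, so that the
   points [x i] are close to one another and carry almost no weight outside of
   [C]. *)
Lemma exists_grid_rainbow :
  exists (C : {set I}) (l : I -> nat) (x : I -> I -> nat),
    [/\ exists i, i \in C,
        forall i, i \in C -> c (x i) = i /\ \sum_k x i k = m,
        forall i k, i \in C -> k \in C -> l k <= x i k &
        m <= \sum_(k in C) l k + #|I|].
Proof.
pose col (v : T + I) := match v with inl t => c (coord t) | inr j => j end.
have [| | |X domX rainbowX] :=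
    @exists_rainbow_dominating I _ rk col inr rk_inj _ _ _ i0.
- by [].
- by move=> i y /=; rewrite eqxx.
- move=> i j [t|k] ji; last by rewrite codom_f.
  move=> _; apply: leq_trans (rk_lt i t) _; rewrite /= eq_sym (negbTE ji).
  by rewrite ltnS leq_addr.
(* A slack vector has rank 0 in its own order, below every grid point, so a grid point can only be
   dominated in an order whose slack vector is absent from [X]. *)
have domC t : exists2 i, inr i \notin X &
    forall t', inl t' \in X -> coord t i <= coord t' i.
  have [i iP] := domX (inl t); exists i.
    by apply/negP => /iP /=; rewrite eqxx.
  by move=> t' /iP /rk_le.
have [t0 _] : exists t, coord t =1 (fun i => if i == i0 then m else 0).
  by apply: mk_point; rewrite -big_mkcond/= big_pred1_eq.
have [i1 i1X _] := domC t0.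
(* The only slack vector of colour [i] is [inr i]; when it is absent, the colour comes from a grid
   point. *)
have wit i : exists t, inr i \notin X -> inl t \in X /\ c (coord t) = i.
  have [x xX cx] := rainbowX i; case: x xX cx => [t|j] xX cx.
    by exists t.
  by exists t0; rewrite -cx xX.
have [w wP] := fin_all_exists wit.
pose mn k := [arg min_(t < w i1 | inl t \in X) coord t k].
have mnP k : inl (mn k) \in X /\ forall t, inl t \in X -> coord (mn k) k <= coord t k.
  rewrite /mn; case: arg_minnP; last by move=> t tX tmin; split.
  exact: (wP i1 i1X).1.
exists [set i | inr i \notin X]%SET, (fun k => coord (mn k) k), (fun i => coord (w i)).
split.
- by exists i1; rewrite finset.inE.
- by move=> i; rewrite finset.inE => /wP[_ ->]; split.
- by move=> i k; rewrite finset.inE => /wP[+ _] _; exact: (mnP k).2.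
set S := \sum_(k in _) _; rewrite leqNgt; apply/negP => Sm.
(* Were the minima to sum to less than [m - #|I|], raising each of them by one would leave a total
   of at most [m]. With the remainder added at [i1], this is a grid point above all the minima,
   contrary to [domC]. *)
pose S' := \sum_(k | inr k \notin X) (coord (mn k) k).+1.
have S'm : S' <= m.
  apply: leq_trans (ltnW Sm); rewrite /S'.
  under eq_bigr do rewrite -addn1.
  rewrite big_split/= sum1_card; apply: leq_add; last exact: max_card.
  by rewrite /S; apply/eq_leq/eq_bigl => k; rewrite finset.inE.
have [t tE] : exists t, coord t =1 fun k =>
    (if inr k \notin X then (coord (mn k) k).+1 else 0) +
    (if k == i1 then m - S' else 0).
  by apply: mk_point; rewrite big_split/= -!big_mkcond/= big_pred1_eq subnKC.
have [i iX /(_ _ (mnP i).1)] := domC t.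
by rewrite tE iX addSn ltnNge leq_addr.
Qed.

End GridRainbow.

(** * Schauder's fixed point theorem *)

Definition uclose (R : realType) (J : Type) (e : R) (x y : J -> R) : Prop :=
  forall j, `|x j - y j| <= e.

Definition convex_set_fun (R : realType) (J : Type) (M : set (J -> R)) : Prop :=
  forall n (l : 'I_n -> R) (y : 'I_n -> J -> R),
    (forall i, 0 <= l i) -> \sum_i l i = 1 -> (forall i, M (y i)) ->
    M (fun j => \sum_i l i * y i j).

Section ApproximateFixedPoint.
Variables (R : realType) (J : Type) (M : set (J -> R)) (S : (J -> R) -> J -> R).
Variable B : R.
Hypothesis convM : convex_set_fun M.
Hypothesis B_gt0 : 0 < B.
Hypothesis bndM : forall x j, M x -> `|x j| <= B.
Hypothesis SM : forall x, M x -> M (S x).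
Hypothesis S_unif : forall e : R, 0 < e -> exists2 d : R, 0 < d &
  forall x y, M x -> M y -> uclose d x y -> uclose e (S x) (S y).

(** Three errors of size [e] add up: the distance from an image to the net point that colours it,
    the variation of [S] across the rainbow family, and the weight carried outside [C]. *)
Lemma approximate_fixed_point (e : R) (n : nat) (y : 'I_n -> J -> R) :
  0 < e -> M !=set0 -> (forall i, M (y i)) ->
  (forall z, M z -> exists i, uclose e z (y i)) ->
  exists2 x, M x & uclose (3 * e) x (S x).
Proof.
move=> e0 [z0 Mz0] My net.
have [i0 _] := net _ Mz0.
have [d d0 dP] := S_unif e0.
pose h := Num.min d e.
have h0 : 0 < h by rewrite lt_min d0 e0.
(* So fine a grid that weights differing by [2 * n] in total give combinations at distance at most
   [h]. *)
pose m := (Num.truncn (2 * n%:R * B / h)).+1.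
have m0 : 0 < m%:R :> R by rewrite ltr0n.
have mh : 2 * n%:R * B / m%:R <= h.
  rewrite ler_pdivrMr// [leRHS]mulrC -ler_pdivrMr//; apply/ltW.
  by rewrite /m; apply: truncnS_gt.
pose pt (t : 'I_n -> nat) j : R := \sum_i (t i)%:R / m%:R * y i j.
have sum_wt (t : 'I_n -> nat) : (\sum_i t i)%N = m ->
    \sum_i (t i)%:R / m%:R = 1 :> R.
  by move=> tm; rewrite -mulr_suml -natr_sum tm divff// gt_eqF.
have Mpt t : (\sum_i t i)%N = m -> M (pt t).
  by move=> tm; apply: convM => [i||i]; [rewrite divr_ge0|exact: sum_wt|].
(* The colour is meaningful on the grid of the simplex only; elsewhere it defaults to [i0]. *)
have /choice[c cP] : forall t : 'I_n -> nat, exists i,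
    (\sum_i t i)%N = m -> uclose e (S (pt t)) (y i).
  move=> t; have [tm|tm] := pselect ((\sum_i t i)%N = m); last by exists i0.
  by have [i iP] := net _ (SM (Mpt t tm)); exists i.
have [C [l [x [[i1 i1C] xP lx ml]]]] := exists_grid_rainbow i0 m c.
(* With the value 0 outside [C], any weight there counts entirely as excess over [lr], and the total
   excess of a point of the family is at most [n]. *)
pose lr k : R := if k \in C then (l k)%:R else 0.
have lr_le i k : i \in C -> lr k <= (x i k)%:R.
  by move=> iC; rewrite /lr; case: ifPn => // kC; rewrite ler_nat lx.
have lr_sum : m%:R - \sum_k lr k <= n%:R.
  rewrite lerBlDl /lr -big_mkcond/= -natr_sum -natrD ler_nat.
  by move: ml; rewrite card_ord.
(* Both weight vectors lie above [lr] with an excess of at most [n] each. *)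
have close_pt i j : i \in C -> `|pt (x i) j - pt (x i1) j| <= h.
  move=> iC; apply: le_trans mh; rewrite /pt -sumrB.
  apply: le_trans (ler_norm_sum _ _ _) _.
  apply: (@le_trans _ _ (\sum_k ((x i k)%:R + (x i1 k)%:R - 2 * lr k) * (B / m%:R))).
    apply: ler_sum => k _; rewrite -mulrBl -mulrBl !normrM.
    rewrite [`|_^-1|]gtr0_norm ?invr_gt0// -mulrA [_^-1 * _]mulrC.
    apply: ler_pM => //.
      have := lr_le i k iC; have := lr_le i1 k i1C.
      by rewrite ler_norml; move=> *; apply/andP; split; lra.
    by rewrite ler_pM2r ?invr_gt0//; exact: bndM.
  rewrite -mulr_suml mulrA ler_pM2r ?invr_gt0// ler_pM2r//.
  rewrite big_split/= big_split/= -!natr_sum (xP _ iC).2 (xP _ i1C).2.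
  rewrite sumrN -mulr_sumr; lra.
exists (pt (x i1)) => [|j]; first by apply: Mpt; exact: (xP _ i1C).2.
set u := S _ j.
(* One [e] comes from the colour of [x i], the other from replacing [x i] by [x i1] under [S]. *)
have yu i : i \in C -> `|y i j - u| <= 2 * e.
  move=> iC; have [cxi sxi] := xP _ iC.
  have := cP _ sxi j; rewrite cxi => h1.
  have h2 : uclose e (S (pt (x i))) (S (pt (x i1))).
    apply: dP; [exact: Mpt|exact: Mpt (xP _ i1C).2|move=> j'].
    by apply: le_trans (close_pt i j' iC) _; rewrite ge_min lexx.
  have := h2 j; move: h1; rewrite -/u !ler_norml => /andP[? ?] /andP[? ?].
  by apply/andP; split; lra.
have Bu k : `|y k j - u| <= 2 * B.
  have : `|u| <= B by apply/bndM/SM/Mpt; exact: (xP _ i1C).2.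
  have := @bndM _ j (My k); rewrite !ler_norml => /andP[? ?] /andP[? ?].
  by apply/andP; split; lra.
have -> : pt (x i1) j - u = \sum_k (x i1 k)%:R / m%:R * (y k j - u).
  under [RHS]eq_bigr do rewrite mulrBr.
  by rewrite sumrB -mulr_suml sum_wt ?mul1r//; exact: (xP _ i1C).2.
apply: le_trans (ler_norm_sum _ _ _) _.
apply: (@le_trans _ _ (\sum_k ((x i1 k)%:R / m%:R * (2 * e) +
    ((x i1 k)%:R - lr k) / m%:R * (2 * B)))).
  apply: ler_sum => k _; rewrite normrM ger0_norm ?divr_ge0//.
  have [kC|kC] := boolP (k \in C).
    apply: ler_wpDr; last by apply: ler_wpM2l; [rewrite divr_ge0|exact: yu].
    rewrite mulr_ge0 ?divr_ge0 ?subr_ge0 ?lr_le//.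
    by rewrite mulr_ge0// ltW.
  rewrite /lr (negbTE kC) subr0; apply: ler_wpDl.
    by rewrite mulr_ge0 ?divr_ge0// mulr_ge0// ltW.
  by apply: ler_wpM2l; [rewrite divr_ge0|exact: Bu].
rewrite big_split/= -mulr_suml sum_wt ?(xP _ i1C).2// mul1r.
rewrite -mulr_suml -mulr_suml sumrB -natr_sum (xP _ i1C).2.
suff : (m%:R - \sum_k lr k) / m%:R * (2 * B) <= e by lra.
have : 2 * n%:R * B / m%:R <= e by apply: le_trans mh _; rewrite ge_min lexx orbT.
apply: le_trans; rewrite [leRHS]mulrAC [leRHS](_ : _ = n%:R / m%:R * (2 * B)); last by ring.
by rewrite ler_pM2r ?mulr_gt0// ler_pM2r// invr_gt0.
Qed.

End ApproximateFixedPoint.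

Lemma nbhs_ptws_coord (R : realType) (J : eqType) (x : {ptws J -> R}) j (d : R) : 0 < d ->
  nbhs x [set y | `|x j - y j| <= d].
Proof.
move=> d0.
have h : (fun y : {ptws J -> R} => y j) @ x --> x j.
  exact: (@proj_continuous J (fun=> R) j x).
apply: (h [set z | `|x j - z| <= d]).
exact: (@cvgr_dist_le R R _ (nbhs (x j)) _ id).
Qed.

Section Schauder.
Variables (R : realType) (J : eqType).
Variables (M : set {ptws J -> R}) (S : (J -> R) -> J -> R) (B : R).
Hypothesis M_neq0 : M !=set0.
Hypothesis closedM : closed M.
Hypothesis convM : convex_set_fun M.
Hypothesis bndM : forall x j, M x -> `|x j| <= B.
Hypothesis M_equi : forall e : R, 0 < e -> exists s : seq J, exists2 d : R, 0 < d &
  forall x y, M x -> M y -> (forall j, j \in s -> `|x j - y j| <= d) -> uclose e x y.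
Hypothesis SM : forall x, M x -> M (S x).
Hypothesis S_unif : forall e : R, 0 < e -> exists2 d : R, 0 < d &
  forall x y, M x -> M y -> uclose d x y -> uclose e (S x) (S y).

(** By [M_equi] finitely many coordinates control the uniform distance on [M]. Compactness can thus
    be taken from Tychonoff's theorem in the pointwise topology and used for uniform closeness. *)
Let nbhs_uclose (x : {ptws J -> R}) (e : R) : M x -> 0 < e ->
  nbhs x [set y | M y -> uclose e x y].
Proof.
move=> Mx e0; have [s [d d0 sP]] := M_equi e0.
have Fx := nbhs_filter x.
suff : nbhs x [set y : {ptws J -> R} | forall j, j \in s -> `|x j - y j| <= d].
  by apply: (@filterS _ _ Fx) => y xy My; exact: sP.
elim: s {sP} => [|j s IH].
  by apply: (@filterS _ _ Fx _ _ _ (@filterT _ _ Fx)).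
apply: (@filterS _ _ Fx _ _ _ (@filterI _ _ Fx _ _ (nbhs_ptws_coord x j d0) IH)).
by move=> y [/= yj ys] i; rewrite inE => /predU1P[->|/ys].
Qed.

Let compactM : compact M.
Proof.
have cB : compact ([set f | forall j, f j \in `[- B, B]] : set {ptws J -> R}).
  apply: (@tychonoff J (fun=> R) (fun=> [set z | z \in `[- B, B]])) => j.
  exact: segment_compact.
apply: (subclosed_compact closedM cB) => x Mx j /=.
by rewrite in_itv/= -ler_norml; exact: bndM.
Qed.

HB.instance Definition _ := isPointed.Build {ptws J -> R} (fun=> 0).

Let exists_net (e : R) : 0 < e -> exists n, exists y : 'I_n -> J -> R,
  (forall i, M (y i)) /\ forall z, M z -> exists i, uclose e z (y i).
Proof.
move=> e0.
have cM : cover_compact M by rewrite -compact_cover; exact: compactM.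
have [| |D DM Dcov] := cM _ M (fun x => interior [set y | M y -> uclose e x y]).
- by move=> x _; exact: open_interior.
- by move=> x Mx; exists x => //; exact: nbhs_uclose.
pose s := finmap.enum_fset D.
exists (size s), (fun i => nth point s i); split.
  by move=> i; apply/set_mem/DM/mem_nth.
move=> z Mz; have [x /= xD /interior_subset/= xz] := Dcov _ Mz.
have xs : (index x s < size s)%N by rewrite index_mem.
by exists (Ordinal xs) => j /=; rewrite nth_index// distrC; exact: xz.
Qed.

(** Let the displacement of [x] at [j] be [4 * h]. For [y] near [x], the passages from [x] to [y]
    and from [S x] to [S y] cost at most [h] each, so a displacement of [y] of at most [h] is
    impossible. *)
Let displacement_far (x : {ptws J -> R}) : M x -> ~ (forall j, S x j = x j) ->
  exists2 e : R, 0 < e & nbhs x [set y | M y -> ~ uclose e y (S y)].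
Proof.
move=> Mx /existsNP[j /eqP Sxj].
pose h := `|x j - S x j| / 4.
have h0 : 0 < h by rewrite divr_gt0// normr_gt0 subr_eq0 eq_sym.
have [d d0 dS] := S_unif h0.
have m0 : 0 < Num.min d h by rewrite lt_min d0 h0.
exists h => //; apply: (@filterS _ _ (nbhs_filter x) _ _ _ (nbhs_uclose Mx m0)).
move=> y /= xy My ySy; have {}xy := xy My.
have xyd : uclose d x y by move=> i; rewrite (le_trans (xy i))// ge_min lexx.
have xyh : `|x j - y j| <= h by rewrite (le_trans (xy j))// ge_min lexx orbT.
have : `|x j - S x j| <= h + h + h.
  rewrite [X in `|X|](_ : _ = (x j - y j) + (y j - S y j) + (S y j - S x j)); last by ring.
  apply: le_trans (ler_normD _ _) (lerD _ _).
    exact: le_trans (ler_normD _ _) (lerD xyh (ySy j)).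
  by rewrite distrC; exact: dS.
by have : `|x j - S x j| = 4 * h; [rewrite /h; field|lra].
Qed.

Theorem schauder_fixed_point : exists2 x, M x & forall j, S x j = x j.
Proof.
pose B' := `|B| + 1.
have B'0 : 0 < B' by rewrite ltr_wpDl.
have bndM' x j : M x -> `|x j| <= B'.
  by move=> /bndM/le_trans; apply; rewrite (le_trans (ler_norm _))// lerDl.
apply: contrapT => nfix.
(* Compactness turns the local lower bounds on the displacement into a uniform one, which
   contradicts the approximate fixed point given by an [e / 3]-net. *)
have far : \forall e \near (0 : R)^'+,
    M `<=` (fun x => M x -> ~ uclose e x (S x)).
  have /compact_near_coveringP cov := compactM.
  apply: cov => x Mx.
  have [|e e0 xe] := @displacement_far x Mx.
    by move=> Sx; apply: nfix; exists x.
  exists ([set y | M y -> ~ uclose e y (S y)], [set e' | e' <= e]) => /=.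
    by split => //; exact: nbhs_right_le.
  move=> [y e'] /= [ye e'e] My ye'; apply: ye => // j.
  exact: le_trans (ye' j) e'e.
near (0 : R)^'+ => e.
have e0 : 0 < e by near: e; exact: nbhs_right_gt.
have nM : M `<=` (fun x => M x -> ~ uclose e x (S x)) by near: e.
have e3 : 0 < e / 3 by rewrite divr_gt0.
have [n [y [My ny]]] := exists_net e3.
have [x Mx] := approximate_fixed_point convM B'0 bndM' SM S_unif e3 M_neq0 My ny.
rewrite [3 * _](_ : _ = e); last by field.
exact: nM.
Unshelve. all: by end_near.
Qed.

End Schauder.

(** * Real analysis *)

Section Halfspaces.
Variables (R : realType) (J : eqType) (A : R -> J -> R -> J -> R -> Prop).

(** All the constraints imposed later are affine inequalities in at most two coordinates, so
    convexity and pointwise closedness are settled here once for any number of them. *)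
Definition halfspaces : set {ptws J -> R} :=
  [set x | forall p i q j r, A p i q j r -> p * x i + q * x j <= r].

Lemma convex_halfspaces : convex_set_fun halfspaces.
Proof.
move=> n l y l0 l1 yM p i q j r Ar.
rewrite !mulr_sumr -big_split/= -[leRHS]mul1r -l1 mulr_suml.
apply: ler_sum => k _; rewrite !(mulrCA _ (l k)) -mulrDr.
by apply: ler_wpM2l; [exact: l0|exact: yM].
Qed.

Lemma closed_halfspaces : closed halfspaces.
Proof.
move=> x clx p i q j r Ar; apply/ler_addgt0Pr => e e0.
pose d := e / (`|p| + `|q| + 1).
have pq0 : 0 < `|p| + `|q| + 1 by rewrite ltr_wpDl// addr_ge0.
have d0 : 0 < d by rewrite divr_gt0.
have [y [yM [/= yi yj]]] := clx _ (@filterI _ _ (nbhs_filter x) _ _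
  (nbhs_ptws_coord x i d0) (nbhs_ptws_coord x j d0)).
have {}yM := yM _ _ _ _ _ Ar.
rewrite -lerBlDl (le_trans _ (_ : `|p| * d + `|q| * d <= _))//; last first.
  rewrite -mulrDl /d mulrCA -[leRHS]mulr1 ler_pM2l// ler_pdivrMr// mul1r lerDl//.
have : p * (x i - y i) <= `|p| * d.
  by rewrite (le_trans (ler_norm _))// normrM ler_wpM2l.
have : q * (x j - y j) <= `|q| * d.
  by rewrite (le_trans (ler_norm _))// normrM ler_wpM2l.
by lra.
Qed.

End Halfspaces.

(** Heine-Cantor with only the first point confined to [K]: continuity is meant in the ambient
    space, and the covering argument yields a radius valid on whole balls centred in [K]. *)
Lemma compact_uniformly_continuous (R : realType) (T : pseudoMetricType R)
    (K : set T) (f : T -> R) (e : R) :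
  compact K -> (forall x, K x -> {for x, continuous f}) -> 0 < e ->
  exists2 d : R, 0 < d & forall x y, K x -> ball x d y -> `|f x - f y| <= e.
Proof.
move=> /compact_near_coveringP cov cf e0.
have : \forall d \near (0 : R)^'+,
    K `<=` (fun x => forall y, ball x d y -> `|f x - f y| <= e).
  apply: cov => x Kx.
  have e20 : 0 < e / 2 by rewrite divr_gt0.
  have /cvgrPdist_le/(_ _ e20)/nbhs_ballP[r /= r0 fr] := cf x Kx.
  have r20 : 0 < r / 2 by rewrite divr_gt0.
  exists (ball x (r / 2), [set d | d <= r / 2]) => /=.
    by split; [exact: nbhsx_ballx|exact: nbhs_right_le].
  move=> [y d] /= [xy dr] z yz.
  have fxy : `|f x - f y| <= e / 2.
    by apply: fr; apply: le_ball xy; rewrite ler_pdivrMr// ler_pMr// lerDl.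
  have fxz : `|f x - f z| <= e / 2.
    by apply: fr; rewrite [r]splitr; apply: ball_triangle xy (le_ball dr yz).
  move: fxy fxz; rewrite !ler_norml => /andP[? ?] /andP[? ?].
  by apply/andP; split; lra.
move=> H; near (0 : R)^'+ => d.
have Kd : K `<=` (fun x => forall y, ball x d y -> `|f x - f y| <= e) by near: d.
by exists d => [|x y Kx]; [near: d; exact: nbhs_right_gt|exact: Kd].
Unshelve. all: by end_near.
Qed.

Lemma continuous_comp_within (R : realType) (T U : topologicalType) (D : set U)
    (p : T -> U) (f : U -> R) :
  continuous p -> (forall x, D (p x)) -> {within D, continuous f} ->
  continuous (f \o p).
Proof.
move=> cp pD /subspace_continuousP cf x.
apply: cvg_comp (cf _ (pD x)) => B /= /(cp x) pB.
by apply: (@filterS _ (nbhs x) _ [set z | D (p z) -> B (p z)]) pB => z; apply; exact: pD.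
Qed.

Section Extrema.
Variables (R : realType) (D : set R) (w : R -> R).

(** The lower bound [m] ensures that [inf] is a genuine infimum and not a default value. *)
Lemma min_on_le m t : (forall s, D s -> m <= w s) -> D t -> min_on D w <= w t.
Proof.
move=> wm Dt; apply: ge_inf; last by exists t.
by exists m => _ [s Ds <-]; exact: wm.
Qed.

Lemma min_on_ge m : D !=set0 -> (forall s, D s -> m <= w s) -> m <= min_on D w.
Proof.
move=> [t Dt] wm; apply: lb_le_inf; first by exists (w t), t.
by move=> _ [s Ds <-]; exact: wm.
Qed.

Lemma max_on_ge m t : (forall s, D s -> w s <= m) -> D t -> w t <= max_on D w.
Proof.
move=> wm Dt; apply: ub_le_sup; last by exists t.
by exists m => _ [s Ds <-]; exact: wm.
Qed.

Lemma max_on_le m : D !=set0 -> (forall s, D s -> w s <= m) -> max_on D w <= m.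
Proof.
move=> [t Dt] wm; apply: ge_sup; first by exists (w t), t.
by move=> _ [s Ds <-]; exact: wm.
Qed.

End Extrema.

Section SegmentIntegral.
Variable R : realType.
Local Notation mu := (@lebesgue_measure R).
Implicit Types (a b : R) (h g : R -> R).

Lemma integrable_continuous_segment a b h : continuous h ->
  mu.-integrable `[a, b] (EFin \o h).
Proof.
move=> ch; apply: continuous_compact_integrable; first exact: segment_compact.
exact: continuous_subspaceT.
Qed.

Lemma le_segment_Rintegral a b h g : continuous h -> continuous g ->
  (forall s, s \in `[a, b] -> h s <= g s) ->
  \int[mu]_(s in `[a, b]) h s <= \int[mu]_(s in `[a, b]) g s.
Proof.
by move=> ch cg hg; apply: le_Rintegral => //; exact: integrable_continuous_segment.
Qed.

Lemma segment_RintegralZ a b h r : continuous h ->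
  \int[mu]_(s in `[a, b]) (r * h s) = r * \int[mu]_(s in `[a, b]) h s.
Proof.
by move=> ch; apply: RintegralZl => //; exact: integrable_continuous_segment.
Qed.

(** The interval has length 1, so [e] is the integral of the constant [e]. *)
Lemma unitI_Rintegral_dist h g (e : R) : continuous h -> continuous g ->
  (forall s, unitI s -> `|h s - g s| <= e) ->
  `|\int[mu]_(s in @unitI R) h s - \int[mu]_(s in @unitI R) g s| <= e.
Proof.
have bnd (h1 h2 : R -> R) : continuous h1 -> continuous h2 ->
    (forall s, unitI s -> h1 s <= h2 s + e) ->
    \int[mu]_(s in @unitI R) h1 s <= \int[mu]_(s in @unitI R) h2 s + e.
  move=> c1 c2 h12.
  have ce : continuous (fun _ : R => e) by move=> ?; exact: cvg_cst.
  have -> : e = \int[mu]_(s in @unitI R) e.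
    rewrite Rintegral_cst; last exact: measurable_itv.
    rewrite [X in fine X](_ : _ = 1%E) ?mulr1//.
    have := @lebesgue_measure_itv R `[0, 1]; rewrite /= lte_fin ltr01 => H.
    by apply: etrans H _; rewrite -EFinB subr0.
  have mI : measurable (@unitI R : set (measurableTypeR R)) by exact: measurable_itv.
  rewrite -RintegralD//; try exact: integrable_continuous_segment.
  apply: le_segment_Rintegral => // s.
  by apply: cvgD; [exact: c2|exact: ce].
move=> ch cg hg; rewrite ler_norml; apply/andP; split.
  rewrite lerNl opprB lerBlDl; apply: bnd => // s /hg.
  by rewrite ler_norml => /andP[? _]; lra.
rewrite lerBlDl; apply: bnd => // s /hg.
by rewrite ler_norml => /andP[_ ?]; lra.
Qed.

Lemma le_subset_Rintegral a b h : continuous h ->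
  (forall s, unitI s -> 0 <= h s) -> `[a, b] `<=` @unitI R ->
  \int[mu]_(s in `[a, b]) h s <= \int[mu]_(s in @unitI R) h s.
Proof.
move=> ch h0 abI; apply: fine_le.
- apply: integrable_fin_num; first exact: measurable_itv.
  exact: (integrable_continuous_segment a b ch).
- apply: integrable_fin_num; first exact: measurable_itv.
  exact: (integrable_continuous_segment 0 1 ch).
apply: ge0_subset_integral => //; first exact: measurable_itv.
  have /integrableP[mh _] := integrable_continuous_segment 0 1 ch; exact: mh.
Qed.

End SegmentIntegral.

(** The retraction of the line onto the unit interval. Composing the data with it gives functions
    continuous on the whole space, with the same values on [unitI]. *)
Definition clamp01 (R : realType) (t : R) : R := Num.max 0 (Num.min t 1).

Lemma clamp01_dist (R : realType) (t s : R) : `|clamp01 t - clamp01 s| <= `|t - s|.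
Proof.
rewrite /clamp01 ler_norml.
have /andP[? ?] : - `|t - s| <= t - s <= `|t - s| by rewrite -ler_norml.
have ? : 0 <= `|t - s| by [].
case: (leP t 1) => ?; case: (leP s 1) => ?; rewrite ?(max_r ler01).
- by case: (leP 0 t) => ?; case: (leP 0 s) => ?; apply/andP; split; lra.
- by case: (leP 0 t) => ?; apply/andP; split; lra.
- by case: (leP 0 s) => ?; apply/andP; split; lra.
- by apply/andP; split; lra.
Qed.

Section Clamp.
Variable R : realType.

Lemma clamp01_unitI (t : R) : unitI (clamp01 t).
Proof.
by rewrite /unitI/= in_itv/= /clamp01 le_max lexx ge_max ler01 ge_min lexx orbT.
Qed.

Lemma clamp01_id (t : R) : unitI t -> clamp01 t = t.
Proof.
rewrite /unitI/= in_itv/= /clamp01 => /andP[t0 t1].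
by rewrite (min_idPl t1) (max_idPr t0).
Qed.

Lemma continuous_max0 : continuous (fun x : R => Num.max 0 x).
Proof.
move=> x; apply: (@continuous_max R R (fun=> 0) id x); first exact: cvg_cst.
exact: cvg_id.
Qed.

Lemma continuous_clamp01 : continuous (@clamp01 R).
Proof.
move=> t; apply: (@continuous_comp _ _ _ (fun x : R => Num.min x 1)).
  apply: (@continuous_min R R id (fun=> 1) t); first exact: cvg_id.
  exact: cvg_cst.
exact: continuous_max0.
Qed.

Definition clamp_square (z : R * R) : R * R := (clamp01 z.1, clamp01 z.2).

Let continuous_comp_fst (T U : topologicalType) (f : T -> R) :
  continuous f -> continuous (fun z : T * U => f z.1).
Proof. by move=> cf z; apply: continuous_comp (cf _); exact: cvg_fst. Qed.

Let continuous_comp_snd (T U : topologicalType) (f : U -> R) :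
  continuous f -> continuous (fun z : T * U => f z.2).
Proof. by move=> cf z; apply: continuous_comp (cf _); exact: cvg_snd. Qed.

Lemma continuous_clamp_square : continuous clamp_square.
Proof.
move=> z.
have h1 := @continuous_comp_fst R R _ continuous_clamp01 z.
have h2 := @continuous_comp_snd R R _ continuous_clamp01 z.
exact: (cvg_pair h1 h2).
Qed.

Lemma clamp_square_unitI z : (@unitI R `*` @unitI R) (clamp_square z).
Proof. by split; exact: clamp01_unitI. Qed.

Definition clamp_box (z : R * R * R) : R * R * R :=
  (clamp01 z.1.1, Num.max 0 z.1.2, Num.max 0 z.2).

Lemma continuous_clamp_box : continuous clamp_box.
Proof.
move=> z.
have h1 := @continuous_comp_fst _ R _
  (@continuous_comp_fst R R _ continuous_clamp01) z.
have h2 := @continuous_comp_fst _ R _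
  (@continuous_comp_snd R R _ continuous_max0) z.
have h3 := @continuous_comp_snd (R * R)%type R _ continuous_max0 z.
exact: (cvg_pair (cvg_pair h1 h2) h3).
Qed.

Lemma clamp_box_in z : (@unitI R `*` @Rplus R `*` @Rplus R) (clamp_box z).
Proof.
by split; [split; [exact: clamp01_unitI|]|];
  rewrite /Rplus/= in_itv/= andbT le_max lexx.
Qed.

End Clamp.

(** * Hammerstein operators *)

Definition hammerstein (R : realType) (k : R * R -> R) (f : R * R * R -> R)
    (u v : R -> R) (t : R) : R :=
  \int[@lebesgue_measure R]_(s in @unitI R) (k (t, s) * f (s, u s, v s)).

Section Hammerstein.
Variables (R : realType) (k : R * R -> R) (f : R * R * R -> R).
Hypotheses (ck : continuous k) (cf : continuous f).
Variables (u v : R -> R).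
Hypotheses (cu : continuous u) (cv : continuous v).

Lemma continuous_kernel_section t : continuous (fun s => k (t, s)).
Proof.
move=> s.
have h1 : (fun=> t) @ s --> t by exact: cvg_cst.
have h2 : id @ s --> s by exact: cvg_id.
exact: (cvg_comp _ _ (cvg_pair h1 h2) (@ck (t, s))).
Qed.

Lemma continuous_nemytskii : continuous (fun s => f (s, u s, v s)).
Proof.
move=> s; have h : id @ s --> s by exact: cvg_id.
exact: (cvg_comp _ _ (cvg_pair (cvg_pair h (@cu s)) (@cv s)) (@cf (s, u s, v s))).
Qed.

Lemma continuous_hammerstein_integrand t :
  continuous (fun s => k (t, s) * f (s, u s, v s)).
Proof.
move=> s; apply: cvgM; first exact: continuous_kernel_section.
exact: continuous_nemytskii.
Qed.

Lemma hammerstein_ge0 t : (forall z, 0 <= k z) -> (forall z, 0 <= f z) ->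
  0 <= hammerstein k f u v t.
Proof. by move=> k0 f0; apply: Rintegral_ge0 => s _; exact: mulr_ge0. Qed.

Lemma hammerstein_cone c t t' : (forall z, 0 <= f z) ->
  (forall s, unitI s -> c * k (t', s) <= k (t, s)) ->
  c * hammerstein k f u v t' <= hammerstein k f u v t.
Proof.
move=> f0 ckk; rewrite -segment_RintegralZ; last exact: continuous_hammerstein_integrand.
have ct' := @continuous_hammerstein_integrand t'.
apply: le_segment_Rintegral => [s||s sI].
- by apply: cvgM; [exact: cvg_cst|exact: ct'].
- exact: continuous_hammerstein_integrand.
by rewrite mulrA ler_wpM2r// ckk.
Qed.

Lemma hammerstein_modulus B e t t' : (forall z, 0 <= f z) ->
  (forall s, unitI s -> f (s, u s, v s) <= B) ->
  (forall s, `|k (t, s) - k (t', s)| <= e) ->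
  `|hammerstein k f u v t - hammerstein k f u v t'| <= B * e.
Proof.
move=> f0 fB kk; apply: unitI_Rintegral_dist => [||s sI].
- exact: continuous_hammerstein_integrand.
- exact: continuous_hammerstein_integrand.
by rewrite -mulrBl normrM mulrC (ger0_norm (f0 _)) ler_pM// fB.
Qed.

Lemma hammerstein_le B t : (forall z, 0 <= k z) -> (forall z, 0 <= f z) ->
  (forall s, unitI s -> k (t, s) * f (s, u s, v s) <= B) ->
  hammerstein k f u v t <= B.
Proof.
move=> k0 f0 kfB; apply: le_trans (ler_norm _) _.
have -> : hammerstein k f u v t = hammerstein k f u v t -
    \int[@lebesgue_measure R]_(s in @unitI R) (0 : R).
  by rewrite Rintegral_cst; [rewrite mul0r subr0|exact: measurable_itv].
apply: unitI_Rintegral_dist => [|s|s sI].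
- exact: continuous_hammerstein_integrand.
- exact: cvg_cst.
by rewrite subr0 ger0_norm ?mulr_ge0// kfB.
Qed.

Lemma hammerstein_upper (h : R -> R) t : (forall z, 0 <= k z) -> continuous h ->
  (forall s, unitI s -> f (s, u s, v s) <= h s) ->
  hammerstein k f u v t <= \int[@lebesgue_measure R]_(s in @unitI R) (k (t, s) * h s).
Proof.
move=> k0 ch fh; apply: le_segment_Rintegral => [|s|s sI].
- exact: continuous_hammerstein_integrand.
- by apply: cvgM; [exact: continuous_kernel_section|exact: ch].
by rewrite ler_wpM2l// fh.
Qed.

Lemma hammerstein_lower (h : R -> R) a b t : (forall z, 0 <= k z) ->
  (forall z, 0 <= f z) -> continuous h -> `[a, b] `<=` @unitI R ->
  (forall s, s \in `[a, b] -> h s <= f (s, u s, v s)) ->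
  \int[@lebesgue_measure R]_(s in `[a, b]) (k (t, s) * h s) <= hammerstein k f u v t.
Proof.
move=> k0 f0 ch abI hf.
apply: le_trans (le_subset_Rintegral (@continuous_hammerstein_integrand t) _ abI).
  apply: le_segment_Rintegral => [s||s sab].
  - by apply: cvgM; [exact: continuous_kernel_section|exact: ch].
  - exact: continuous_hammerstein_integrand.
  by rewrite ler_wpM2l// hf.
by move=> s _; exact: mulr_ge0.
Qed.

End Hammerstein.

(** * Uniform continuity on a set of functions, uniformly in a parameter *)

Lemma compact_box (R : realType) (U V : R) :
  compact (@unitI R `*` `[0, U] `*` `[0, V] : set (R * R * R)).
Proof.
apply: compact_setX; last exact: segment_compact.
by apply: compact_setX; exact: segment_compact.
Qed.

(** When the parameter is the index [j] of [S x j], this is precisely the uniform continuity asked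
    of [S] in Schauder's theorem; other parameters allow [S] to be assembled from its
    ingredients. *)
Definition unif_family (R : realType) (J T : Type) (M : set (J -> R))
    (F : T -> (J -> R) -> R) : Prop :=
  forall e : R, 0 < e -> exists2 d : R, 0 < d &
    forall x y, M x -> M y -> uclose d x y -> forall t, `|F t x - F t y| <= e.

Section UniformFamilies.
Variables (R : realType) (J T : Type) (M : set (J -> R)).
Implicit Types F G : T -> (J -> R) -> R.

Lemma unif_family2 F G (P : (J -> R) -> (J -> R) -> T -> Prop) (e1 e2 : R) :
  unif_family M F -> unif_family M G -> 0 < e1 -> 0 < e2 ->
  (forall x y t, M x -> M y -> `|F t x - F t y| <= e1 ->
    `|G t x - G t y| <= e2 -> P x y t) ->
  exists2 d : R, 0 < d &
    forall x y, M x -> M y -> uclose d x y -> forall t, P x y t.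
Proof.
move=> uF uG e10 e20 FGP.
have [d d0 dF] := uF _ e10; have [d' d'0 dG] := uG _ e20.
exists (Num.min d d'); first by rewrite lt_min d0 d'0.
move=> x y Mx My xy t; apply: FGP => //.
  by apply: dF => // j; rewrite (le_trans (xy j))// ge_min lexx.
by apply: dG => // j; rewrite (le_trans (xy j))// ge_min lexx orbT.
Qed.

Lemma unif_family_coord (h : T -> J) : unif_family M (fun t x => x (h t)).
Proof. by move=> e e0; exists e. Qed.

Lemma unif_family_cst (c : T -> R) : unif_family M (fun t _ => c t).
Proof. by move=> e e0; exists 1 => // x y _ _ _ t; rewrite subrr normr0 ltW. Qed.

Lemma unif_family_reindex (T' : Type) (h : T' -> T) F :
  unif_family M F -> unif_family M (fun t => F (h t)).
Proof. by move=> uF e e0; have [d d0 dF] := uF e e0; exists d => // *; exact: dF. Qed.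

Lemma unif_familyD F G : unif_family M F -> unif_family M G ->
  unif_family M (fun t x => F t x + G t x).
Proof.
move=> uF uG e e0; have e20 : 0 < e / 2 by rewrite divr_gt0.
apply: (unif_family2 uF uG e20 e20) => x y t _ _.
rewrite !ler_norml => /andP[? ?] /andP[? ?]; apply/andP; split; lra.
Qed.

Lemma unif_familyN F : unif_family M F -> unif_family M (fun t x => - F t x).
Proof.
move=> uF e e0; have [d d0 dF] := uF e e0; exists d => // x y Mx My xy t.
by rewrite -opprD normrN; exact: dF.
Qed.

Lemma unif_familyM (B : R) F G :
  (forall x t, M x -> `|F t x| <= B) -> (forall x t, M x -> `|G t x| <= B) ->
  unif_family M F -> unif_family M G -> unif_family M (fun t x => F t x * G t x).
Proof.
move=> bF bG uF uG e e0.
pose d := e / (2 * (`|B| + 1)).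
have B0 : 0 < `|B| + 1 by rewrite ltr_wpDl.
have d0 : 0 < d by rewrite divr_gt0// mulr_gt0.
apply: (unif_family2 uF uG d0 d0) => x y t Mx My Fd Gd.
have BB : B <= `|B| + 1 by rewrite (le_trans (ler_norm _))// lerDl.
rewrite (_ : _ - _ = (F t x - F t y) * G t x + F t y * (G t x - G t y)); last by ring.
apply: le_trans (ler_normD _ _) _; rewrite !normrM.
have -> : e = d * (`|B| + 1) + (`|B| + 1) * d by rewrite /d; field; rewrite gt_eqF.
by apply: lerD; apply: ler_pM => //; apply: le_trans BB; [exact: bG|exact: bF].
Qed.

Lemma unif_family_max F G : unif_family M F -> unif_family M G ->
  unif_family M (fun t x => Num.max (F t x) (G t x)).
Proof.
move=> uF uG e e0; apply: (unif_family2 uF uG e0 e0) => x y t _ _.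
rewrite !ler_norml => /andP[? ?] /andP[? ?].
by case: (leP (F t x) (G t x)) => ?; case: (leP (F t y) (G t y)) => ?; apply/andP; split; lra.
Qed.

Lemma unif_family_clamp01 F : unif_family M F ->
  unif_family M (fun t x => clamp01 (F t x)).
Proof.
move=> uF e e0; have [d d0 dF] := uF e e0; exists d => // x y Mx My xy t.
exact: le_trans (clamp01_dist _ _) (dF _ _ Mx My xy t).
Qed.

Lemma unif_familyV (c : R) F : 0 < c -> (forall x t, M x -> c <= F t x) ->
  unif_family M F -> unif_family M (fun t x => (F t x)^-1).
Proof.
move=> c0 Fc uF e e0; have ec0 : 0 < e * (c * c) by rewrite !mulr_gt0.
have [d d0 dF] := uF _ ec0; exists d => // x y Mx My xy t.
have Fx := Fc x t Mx; have Fy := Fc y t My.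
have Fx0 : 0 < F t x by exact: lt_le_trans Fx.
have Fy0 : 0 < F t y by exact: lt_le_trans Fy.
have -> : (F t x)^-1 - (F t y)^-1 = (F t y - F t x) / (F t x * F t y).
  by field; rewrite !gt_eqF.
rewrite normrM normfV [`|F t x * _|]gtr0_norm ?mulr_gt0//.
rewrite ler_pdivrMr ?mulr_gt0// distrC (le_trans (dF _ _ Mx My xy t))//.
by rewrite ler_pM2l// ler_pM// ltW.
Qed.

End UniformFamilies.

Section UniformFamiliesExtrema.
Variables (R : realType) (J T : Type) (M : set (J -> R)).
Variables (F : R -> (J -> R) -> R) (D : set R) (B : R).
Hypotheses (D0 : D !=set0) (uF : unif_family M F).
Hypothesis bF : forall x t, M x -> `|F t x| <= B.

Let FB x t : M x -> - B <= F t x <= B.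
Proof. by move=> Mx; rewrite -ler_norml; exact: bF. Qed.

(** Infima move by no more than the uniform distance of the functions; the bound [B] makes them
    genuine. The result is presented as a constant family over [T], to be combined with others. *)
Lemma unif_family_min_on :
  unif_family M (fun (_ : T) x => min_on D (fun t => F t x)).
Proof.
move=> e e0; have [d d0 dF] := uF e0; exists d => // x y Mx My xy _.
have minle z t : M z -> D t -> min_on D (fun t => F t z) <= F t z.
  by move=> Mz Dt; apply: (@min_on_le _ _ _ (- B)) => // s _; have /andP[] := FB s Mz.
rewrite ler_norml; apply/andP; split.
  rewrite lerNl opprB lerBlDl -lerBlDr; apply: min_on_ge => // t Dt.
  have := minle y t My Dt; have := dF _ _ Mx My xy t.
  by rewrite ler_norml => /andP[? ?] ?; lra.
rewrite lerBlDl -lerBlDr; apply: min_on_ge => // t Dt.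
have := minle x t Mx Dt; have := dF _ _ Mx My xy t.
by rewrite ler_norml => /andP[? ?] ?; lra.
Qed.

Lemma unif_family_max_on :
  unif_family M (fun (_ : T) x => max_on D (fun t => F t x)).
Proof.
move=> e e0; have [d d0 dF] := uF e0; exists d => // x y Mx My xy _.
have maxge z t : M z -> D t -> F t z <= max_on D (fun t => F t z).
  by move=> Mz Dt; apply: (@max_on_ge _ _ _ B) => // s _; have /andP[] := FB s Mz.
rewrite ler_norml; apply/andP; split.
  rewrite lerNl opprB lerBlDl; apply: max_on_le => // t Dt.
  have := maxge x t Mx Dt; have := dF _ _ Mx My xy t.
  by rewrite ler_norml => /andP[? ?] ?; lra.
rewrite lerBlDl; apply: max_on_le => // t Dt.
have := maxge y t My Dt; have := dF _ _ Mx My xy t.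
by rewrite ler_norml => /andP[? ?] ?; lra.
Qed.

End UniformFamiliesExtrema.

(** The arguments of [f] stay in a compact box, where [f] is uniformly continuous, and the kernel is
    bounded. *)
Lemma unif_family_hammerstein (R : realType) (J : Type) (M : set (J -> R))
    (k : R * R -> R) (f : R * R * R -> R) (u v : R -> (J -> R) -> R)
    (K U V : R) :
  continuous k -> continuous f -> (forall t s, `|k (t, s)| <= K) ->
  (forall x, M x -> continuous (u^~ x)) -> (forall x, M x -> continuous (v^~ x)) ->
  (forall x s, M x -> 0 <= u s x <= U) -> (forall x s, M x -> 0 <= v s x <= V) ->
  unif_family M u -> unif_family M v ->
  unif_family M (fun t x => hammerstein k f (u^~ x) (v^~ x) t).
Proof.
move=> ck cf kK cu cv uU vV uu uv e e0.
have K0 : 0 < `|K| + 1 by rewrite ltr_wpDl.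
have eK0 : 0 < e / (`|K| + 1) by rewrite divr_gt0.
have [d d0 df] := @compact_uniformly_continuous R _ _ f _
  (@compact_box R U V) (fun z _ => cf z) eK0.
(* Balls are open whereas [uclose] is a non-strict inequality, hence the half. *)
have d20 : 0 < d / 2 by rewrite divr_gt0.
have d2d : d / 2 < d by rewrite ltr_pdivrMr// ltr_pMr// ltrDl.
have [d' d'0 d'P] : exists2 d' : R, 0 < d' & forall x y, M x -> M y ->
    uclose d' x y -> forall s, `|u s x - u s y| <= d / 2 /\ `|v s x - v s y| <= d / 2.
  exact: (unif_family2 uu uv d20 d20).
exists d' => // x y Mx My xy t; apply: unitI_Rintegral_dist => [||s sI].
- by apply: continuous_hammerstein_integrand => //; [exact: cu|exact: cv].
- by apply: continuous_hammerstein_integrand => //; [exact: cu|exact: cv].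
rewrite -mulrBr normrM.
have -> : e = (`|K| + 1) * (e / (`|K| + 1)) by field; rewrite gt_eqF.
have [us vs] := d'P _ _ Mx My xy s.
apply: ler_pM => //.
  by rewrite (le_trans (kK _ _))// (le_trans (ler_norm _))// lerDl.
apply: df.
  by split; [split=> //|]; rewrite /= in_itv/=; [exact: uU|exact: vV].
split; [split; first exact: ballxx|]; exact: le_lt_trans d2d.
Qed.

Lemma compact_upper_bound (R : realType) (T : topologicalType) (A : set T)
    (f : T -> R) : A !=set0 -> compact A -> continuous f ->
  exists2 B : R, 0 <= B & forall x, A x -> f x <= B.
Proof.
move=> A0 cA cf.
have [c Ac maxf] := compact_EVT_max A0 cA (continuous_subspaceT cf).
exists (Num.max 0 (f c)); first by rewrite le_max lexx.
by move=> x Ax; rewrite le_max maxf ?orbT// inE.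
Qed.

(* A modulus of continuity measured by the kernel itself: it is satisfied by
   [hammerstein K f u v] as soon as [f] is bounded by [L] along [(u, v)], and it
   is a family of affine inequalities in the values of [w]. *)
Definition kernel_modulus (R : realType) (K : R * R -> R) (L : R) (w : R -> R) :
    Prop :=
  forall t t' e, (forall s, `|K (t, s) - K (t', s)| <= e) -> w t - w t' <= L * e.

Section KernelModulus.
Variables (R : realType) (K : R * R -> R) (L : R).
Hypothesis cK : continuous K.
Hypothesis K_clampl : forall t s, K (t, s) = K (clamp01 t, s).
Hypothesis K_clampr : forall t s, K (t, s) = K (t, clamp01 s).
Hypothesis L0 : 0 <= L.

Lemma kernel_modulus_dist w t t' e : kernel_modulus K L w ->
  (forall s, `|K (t, s) - K (t', s)| <= e) -> `|w t - w t'| <= L * e.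
Proof.
move=> Kw tt'; rewrite ler_norml lerNl opprB; apply/andP; split; apply: Kw => // s.
by rewrite distrC.
Qed.

(** The modulus applied with [e = 0]: [w] inherits the invariance of [K] under clamping, so its
    values on [unitI] determine it. *)
Lemma kernel_modulus_clamp w t : kernel_modulus K L w -> w t = w (clamp01 t).
Proof.
move=> Kw; apply/eqP; rewrite -subr_eq0 -normr_le0 -(mulr0 L).
by apply: kernel_modulus_dist => // s; rewrite K_clampl subrr normr0.
Qed.

Lemma kernel_equicontinuous (e : R) : 0 < e -> exists2 d : R, 0 < d &
  forall t t' s, `|t - t'| < d -> `|K (t, s) - K (t', s)| <= e.
Proof.
move=> e0.
have cI : compact (@unitI R `*` @unitI R : set (R * R)).
  by apply: compact_setX; exact: segment_compact.
have [d d0 dK] := @compact_uniformly_continuous R _ _ K _ cI (fun z _ => @cK z) e0.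
exists d => // t t' s tt'.
rewrite K_clampl K_clampr (K_clampl t') (K_clampr _ s); apply: dK.
  by split; exact: clamp01_unitI.
by split; [exact: le_lt_trans (clamp01_dist _ _) tt'|exact: ballxx].
Qed.

Lemma kernel_modulus_continuous w : kernel_modulus K L w -> continuous w.
Proof.
move=> Kw t; apply/cvgrPdist_le => e e0.
have L10 : 0 < L + 1 by rewrite ltr_wpDl.
have [d d0 dK] := kernel_equicontinuous (divr_gt0 e0 L10).
near=> t'; apply: (@le_trans _ _ (L * (e / (L + 1)))).
  apply: kernel_modulus_dist => // s; apply: dK.
  by near: t'; exact: cvgr_dist_lt.
by rewrite mulrCA -[leRHS]mulr1 ler_pM2l// ler_pdivrMr// mul1r lerDl.
Unshelve. all: by end_near.
Qed.

(** The sample points [i / n] have spacing below the common modulus of continuity. Passing through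
    the one just below [clamp01 t] costs [e / 3] for each function and [e / 3] at the sample
    point. *)
Lemma kernel_modulus_equi (e : R) : 0 < e -> exists s : seq R, forall w1 w2,
  kernel_modulus K L w1 -> kernel_modulus K L w2 ->
  (forall t, t \in s -> `|w1 t - w2 t| <= e / 3) -> forall t, `|w1 t - w2 t| <= e.
Proof.
move=> e0; have L10 : 0 < L + 1 by rewrite ltr_wpDl.
have e30 : 0 < e / 3 by rewrite divr_gt0.
have [d d0 dK] := kernel_equicontinuous (divr_gt0 e30 L10).
pose n := (Num.truncn d^-1).+1.
have n0 : 0 < n%:R :> R by rewrite ltr0n.
have nd : n%:R^-1 < d by rewrite invf_plt ?posrE//; exact: truncnS_gt.
exists [seq i%:R / n%:R | i <- iota 0 n.+1] => w1 w2 K1 K2 w12 t.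
have := clamp01_unitI t; rewrite /unitI/= in_itv/= => /andP[t0 t1].
have tn0 : 0 <= clamp01 t * n%:R by rewrite mulr_ge0// ltW.
pose i := Num.truncn (clamp01 t * n%:R).
have /andP[it ti] := truncn_itv tn0.
have i_n : (i < n.+1)%N.
  by rewrite ltnS -(ler_nat R) (le_trans it)// ler_piMl// ltW.
have near_i w : kernel_modulus K L w -> `|w t - w (i%:R / n%:R)| <= e / 3.
  move=> Kw; apply: (@le_trans _ _ (L * (e / 3 / (L + 1)))).
    apply: kernel_modulus_dist => // s; rewrite K_clampl; apply: dK.
    apply: le_lt_trans nd; rewrite ger0_norm ?subr_ge0 ?ler_pdivrMr//.
    rewrite lerBlDr (_ : _ + _ = i.+1%:R / n%:R); last first.
      by rewrite -natr1; field; rewrite gt_eqF.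
    by rewrite ler_pdivlMr// ltW.
  by rewrite mulrCA -[leRHS]mulr1 ler_pM2l// ler_pdivrMr// mul1r lerDl.
have := w12 (i%:R / n%:R); rewrite (map_f (fun i => i%:R / n%:R)) ?mem_iota//.
move=> /(_ isT); have := near_i _ K1; have := near_i _ K2.
rewrite !ler_norml => /andP[? ?] /andP[? ?] /andP[? ?].
by apply/andP; split; lra.
Qed.

End KernelModulus.

(** * The fixed point problem *)

Section Shell.
Variables (R : realType) (K1 K2 : R * R -> R) (F G : R * R * R -> R).
Variables (a b c1 rho1 rho2 alpha beta FB GB B1 B2 : R).
Hypotheses (cK1 : continuous K1) (cK2 : continuous K2).
Hypotheses (cF : continuous F) (cG : continuous G).
Hypotheses (K1_ge0 : forall z, 0 <= K1 z) (K2_ge0 : forall z, 0 <= K2 z).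
Hypotheses (F_ge0 : forall z, 0 <= F z) (G_ge0 : forall z, 0 <= G z).
Hypothesis K1_clampl : forall t s, K1 (t, s) = K1 (clamp01 t, s).
Hypothesis K1_clampr : forall t s, K1 (t, s) = K1 (t, clamp01 s).
Hypothesis K2_clampl : forall t s, K2 (t, s) = K2 (clamp01 t, s).
Hypothesis K2_clampr : forall t s, K2 (t, s) = K2 (t, clamp01 s).
Hypothesis B1_ge0 : 0 <= B1.
Hypothesis K1_le : forall t s, K1 (t, s) <= B1.
Hypothesis K2_le : forall t s, K2 (t, s) <= B2.
Hypotheses (ab : a <= b) (abI : `[a, b] `<=` @unitI R).
Hypotheses (c1_gt0 : 0 < c1) (c1_le1 : c1 <= 1).
Hypothesis K1_cone : forall t t' s, t \in `[a, b] -> c1 * K1 (t', s) <= K1 (t, s).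
Hypotheses (rho1_gt0 : 0 < rho1) (rho2_gt0 : 0 < rho2).
Hypotheses (alpha_gt0 : 0 < alpha) (alpha_lt_beta : alpha < beta).

(** A priori bounds common to both cases: the scale [sc] will lie between [smin] and [smax], and [w]
    below [c1^-1], whence [u] below [Umax]. *)
Let smin := Num.min (c1 * rho2) rho1.
Let smax := Num.max rho2 (rho1 / c1).
Let Umax := smax / c1.

Hypotheses (FB_ge0 : 0 <= FB) (GB_ge0 : 0 <= GB).
Hypothesis F_le : forall z : R * R * R,
  (@unitI R `*` `[0, Umax] `*` `[0, beta]) z -> F z <= FB.
Hypothesis G_le : forall z : R * R * R,
  (@unitI R `*` `[0, Umax] `*` `[0, beta]) z -> G z <= GB.

Hypothesis F_lower : forall u v : R -> R, continuous u -> continuous v ->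
  (forall s, s \in `[a, b] -> rho1 <= u s <= rho1 / c1) ->
  (forall s, alpha <= v s <= beta) ->
  forall t, t \in `[a, b] -> rho1 <= hammerstein K1 F u v t.
Hypothesis F_upper : forall u v : R -> R, continuous u -> continuous v ->
  (forall s, 0 <= u s <= rho2) -> (forall s, alpha <= v s <= beta) ->
  forall t, hammerstein K1 F u v t <= rho2.

(** The ranges of [u] on which the estimates (iii) and (iv) of the second nonlinearity are assumed.
    Stating the cases as implications lets one argument serve both. *)
Definition in_shell (u : R -> R) : Prop :=
  [/\ forall s, 0 <= u s,
      rho1 / c1 < rho2 ->
        (forall s, s \in `[a, b] -> rho1 <= u s) /\ forall s, u s <= rho2 &
      rho2 < rho1 ->
        (forall s, s \in `[a, b] -> c1 * rho2 <= u s) /\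
        forall s, u s <= rho1 / c1].

Hypothesis G_bnd : forall u v : R -> R, continuous u -> continuous v -> in_shell u ->
  (forall s, alpha <= v s <= beta) ->
  forall t, alpha <= hammerstein K2 G u v t <= beta.

(* A point [x] encodes [tau] as [x None], a function [w] of the cone with
   [w a = 1] as [x (Some (true, _))], and [v] as [x (Some (false, _))]. *)
Let J := option (bool * R).
Let w t (x : J -> R) : R := x (Some (true, t)).
Let v t (x : J -> R) : R := x (Some (false, t)).
Let tau (x : J -> R) : R := x None.

Let in01 t : t \in `[a, b] -> unitI t.
Proof. exact: abI. Qed.

Let aab : a \in `[a, b].
Proof. by rewrite in_itv/= lexx. Qed.

(** The nonlinearity is bounded by [FB], and the normalization divides by at least [smin]. *)
Let Lw := FB / smin.

(** The arguments [p i q j r] stand for the inequality [p * x i + q * x j <= r]; constraints on a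
    single coordinate are padded with [0 None]. *)
Inductive shell_constraint : R -> J -> R -> J -> R -> Prop :=
| tau_ge : shell_constraint (-1) None 0 None 0
| tau_le : shell_constraint 1 None 0 None 1
| w_at_a_le : shell_constraint 1 (Some (true, a)) 0 None 1
| w_at_a_ge : shell_constraint (-1) (Some (true, a)) 0 None (-1)
| w_ge t : shell_constraint (-1) (Some (true, t)) 0 None 0
| w_cone t t' : t \in `[a, b] ->
    shell_constraint c1 (Some (true, t')) (-1) (Some (true, t)) 0
| w_modulus t t' e : (forall s, `|K1 (t, s) - K1 (t', s)| <= e) ->
    shell_constraint 1 (Some (true, t)) (-1) (Some (true, t')) (Lw * e)
| v_ge t : shell_constraint (-1) (Some (false, t)) 0 None (- alpha)
| v_le t : shell_constraint 1 (Some (false, t)) 0 None beta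
| v_modulus t t' e : (forall s, `|K2 (t, s) - K2 (t', s)| <= e) ->
    shell_constraint 1 (Some (false, t)) (-1) (Some (false, t')) (GB * e).

Let M := halfspaces shell_constraint.

Let M_intro x : 0 <= tau x <= 1 -> w a x = 1 -> (forall t, 0 <= w t x) ->
  (forall t t', t \in `[a, b] -> c1 * w t' x <= w t x) ->
  kernel_modulus K1 Lw (w^~ x) -> (forall t, alpha <= v t x <= beta) ->
  kernel_modulus K2 GB (v^~ x) -> M x.
Proof.
rewrite /w /v /tau => /andP[? ?] wa w0 wc wm vab vm p i q j r [].
1-4: by lra.
- by move=> t; have := w0 t; lra.
- by move=> t t' tab; have := wc t t' tab; lra.
- by move=> t t' e te; have := wm t t' e te; lra.
- by move=> t; have /andP[? ?] := vab t; lra.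
- by move=> t; have /andP[? ?] := vab t; lra.
- by move=> t t' e te; have := vm t t' e te; lra.
Qed.

Let M_tau x : M x -> 0 <= tau x <= 1.
Proof.
move=> Mx; have := Mx _ _ _ _ _ tau_ge; have := Mx _ _ _ _ _ tau_le.
by rewrite /tau => ? ?; apply/andP; split; lra.
Qed.

Let M_wa x : M x -> w a x = 1.
Proof.
move=> Mx; have := Mx _ _ _ _ _ w_at_a_ge; have := Mx _ _ _ _ _ w_at_a_le.
by rewrite /w => ? ?; lra.
Qed.

Let M_w0 x t : M x -> 0 <= w t x.
Proof. by move=> Mx; have := Mx _ _ _ _ _ (w_ge t); rewrite /w; lra. Qed.

Let M_wcone x t t' : M x -> t \in `[a, b] -> c1 * w t' x <= w t x.
Proof. by move=> Mx tab; have := Mx _ _ _ _ _ (w_cone t' tab); rewrite /w; lra. Qed.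

Let M_wmod x : M x -> kernel_modulus K1 Lw (w^~ x).
Proof. by move=> Mx t t' e te; have := Mx _ _ _ _ _ (w_modulus te); rewrite /w; lra. Qed.

Let M_v x t : M x -> alpha <= v t x <= beta.
Proof.
move=> Mx; have := Mx _ _ _ _ _ (v_ge t); have := Mx _ _ _ _ _ (v_le t).
by rewrite /v => ? ?; apply/andP; split; lra.
Qed.

Let M_vmod x : M x -> kernel_modulus K2 GB (v^~ x).
Proof. by move=> Mx t t' e te; have := Mx _ _ _ _ _ (v_modulus te); rewrite /v; lra. Qed.

Let smin_gt0 : 0 < smin.
Proof. by rewrite /smin lt_min rho1_gt0 mulr_gt0. Qed.

Let Lw_ge0 : 0 <= Lw.
Proof. by rewrite divr_ge0// ltW. Qed.

Let smax_gt0 : 0 < smax.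
Proof. by rewrite /smax lt_max rho2_gt0. Qed.

Let M_wcont x : M x -> continuous (w^~ x).
Proof. by move=> Mx; apply: (kernel_modulus_continuous cK1) (M_wmod Mx). Qed.

Let M_vcont x : M x -> continuous (v^~ x).
Proof. by move=> Mx; apply: (kernel_modulus_continuous cK2) (M_vmod Mx). Qed.

Let Nw (x : J -> R) : R := max_on (@unitI R) (w^~ x).
Let mw (x : J -> R) : R := min_on `[a, b] (w^~ x).

Let w_le x t : M x -> w t x <= c1^-1.
Proof.
move=> Mx; rewrite -[leRHS]mul1r ler_pdivlMr// mulrC -(M_wa Mx).
exact: M_wcone.
Qed.

Let I0 : @unitI R !=set0.
Proof. by exists a; exact: in01. Qed.

Let ab0 : [set` `[a, b]] !=set0.
Proof. by exists a. Qed.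

Let w_le_N x t : M x -> w t x <= Nw x.
Proof.
move=> Mx; have -> : w t x = w (clamp01 t) x.
  exact: (kernel_modulus_clamp K1_clampl t (M_wmod Mx)).
apply: (@max_on_ge _ _ (w^~ x) c1^-1); last exact: clamp01_unitI.
by move=> s _; exact: w_le.
Qed.

Let m_le_w x t : M x -> t \in `[a, b] -> mw x <= w t x.
Proof.
by move=> Mx tab; apply: (@min_on_le _ _ (w^~ x) 0) => // s _; exact: M_w0.
Qed.

Let N_ge1 x : M x -> 1 <= Nw x.
Proof. by move=> Mx; rewrite -(M_wa Mx); exact: w_le_N. Qed.

Let N_le x : M x -> Nw x <= c1^-1.
Proof. by move=> Mx; apply: max_on_le => // s _; exact: w_le. Qed.

Let m_le1 x : M x -> mw x <= 1.
Proof. by move=> Mx; rewrite -(M_wa Mx); exact: m_le_w. Qed.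

Let cN_le_m x : M x -> c1 * Nw x <= mw x.
Proof.
move=> Mx; apply: min_on_ge => // t tab.
rewrite mulrC -ler_pdivlMr//; apply: max_on_le => // s _.
by rewrite ler_pdivlMr// mulrC; exact: M_wcone.
Qed.

Let c_le_m x : M x -> c1 <= mw x.
Proof.
by move=> Mx; apply: le_trans (cN_le_m Mx); rewrite ler_peMr ?N_ge1// ltW.
Qed.

Let sc (x : J -> R) : R :=
  (1 - tau x) * (rho2 * (Nw x)^-1) + tau x * (rho1 * (mw x)^-1).
Let u t (x : J -> R) : R := sc x * w t x.

Let sc_ge x l : M x -> l <= rho2 / Nw x -> l <= rho1 / mw x -> l <= sc x.
Proof.
move=> /M_tau/andP[t0 t1] h1 h2; rewrite /sc -[leLHS]mul1r -{1}(subrK (tau x) 1).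
by rewrite mulrDl lerD// ler_wpM2l// subr_ge0.
Qed.

Let sc_le x l : M x -> rho2 / Nw x <= l -> rho1 / mw x <= l -> sc x <= l.
Proof.
move=> /M_tau/andP[t0 t1] h1 h2; rewrite /sc -[leRHS]mul1r -{2}(subrK (tau x) 1).
by rewrite [leRHS]mulrDl lerD// ler_wpM2l// subr_ge0.
Qed.

Let N_gt0 x : M x -> 0 < Nw x.
Proof. by move=> /N_ge1; exact: lt_le_trans. Qed.

Let m_gt0 x : M x -> 0 < mw x.
Proof. by move=> /c_le_m; exact: lt_le_trans. Qed.

Let sc_min x : M x -> smin <= sc x.
Proof.
move=> Mx; apply: sc_ge => //.
  rewrite ge_min; apply/orP; left; rewrite ler_pdivlMr ?N_gt0//.
  rewrite mulrAC ler_piMl//; first exact: ltW.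
  by rewrite mulrC -ler_pdivlMr// mul1r N_le.
rewrite ge_min; apply/orP; right; rewrite ler_pdivlMr ?m_gt0//.
by rewrite ler_piMr ?m_le1// ltW.
Qed.

Let sc_max x : M x -> sc x <= smax.
Proof.
move=> Mx; apply: sc_le => //; rewrite le_max; apply/orP.
  by left; rewrite ler_pdivrMr ?N_gt0// ler_peMr ?N_ge1// ltW.
right; apply: ler_wpM2l; first exact: ltW.
by rewrite lef_pV2 ?posrE ?m_gt0// c_le_m.
Qed.

Let sc_gt0 x : M x -> 0 < sc x.
Proof. by move=> /sc_min; exact: lt_le_trans. Qed.

Let u_bnd x t : M x -> 0 <= u t x <= Umax.
Proof.
move=> Mx; rewrite mulr_ge0 ?M_w0//=; last by rewrite ltW ?sc_gt0.
by apply: ler_pM; [rewrite ltW ?sc_gt0|exact: M_w0|exact: sc_max|exact: w_le].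
Qed.

(** The cone inequality [c1 * Nw x <= mw x] orders the two radii, and [sc x] is a convex combination
    of them. *)
Let scales_caseA x : rho1 / c1 < rho2 -> M x -> rho1 / mw x <= sc x <= rho2 / Nw x.
Proof.
move=> cA Mx; have h : rho1 / mw x <= rho2 / Nw x.
  rewrite ler_pdivrMr ?m_gt0// mulrAC ler_pdivlMr ?N_gt0//.
  apply: le_trans (_ : rho2 * (c1 * Nw x) <= _); last first.
    by rewrite ler_pM2l// cN_le_m.
  by rewrite mulrA ler_pM2r ?N_gt0// -ler_pdivrMr// ltW.
by rewrite sc_ge// sc_le.
Qed.

(** From [w a x = 1] one has [mw x <= 1 <= Nw x], so the radii are separated by [rho2] and
    [rho1]. *)
Let scales_caseB x : rho2 < rho1 -> M x -> rho2 / Nw x <= sc x <= rho1 / mw x.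
Proof.
move=> cB Mx; have h : rho2 / Nw x <= rho1 / mw x.
  apply: (@le_trans _ _ rho2).
    by rewrite ler_pdivrMr ?N_gt0// ler_peMr ?N_ge1// ltW.
  rewrite ler_pdivlMr ?m_gt0//; apply: le_trans (ltW cB).
  by rewrite ler_piMr ?m_le1// ltW.
by rewrite sc_ge// sc_le.
Qed.

(** In Case A the order of the radii bounds the minimum and the maximum of [u] directly. In Case B
    it gives [sc x * Nw x >= rho2] and [sc x * mw x <= rho1], and the cone inequality converts these
    into a lower bound on [[a, b]] and an upper bound everywhere. *)
Let u_shell x : M x -> in_shell (u^~ x).
Proof.
move=> Mx; split=> [s|cA|cB]; first by have /andP[] := u_bnd s Mx.
  have /andP[h1 h2] := scales_caseA cA Mx; split=> [s sab|s].
    rewrite /u; apply: le_trans (_ : sc x * mw x <= _).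
      by rewrite -ler_pdivrMr// m_gt0.
    by rewrite ler_pM2l ?sc_gt0// m_le_w.
  rewrite /u; apply: (@le_trans _ _ (sc x * Nw x)).
    by rewrite ler_pM2l ?sc_gt0// w_le_N.
  by rewrite -ler_pdivlMr// N_gt0.
have /andP[h1 h2] := scales_caseB cB Mx; split=> [s sab|s].
  rewrite /u; apply: (@le_trans _ _ (sc x * (c1 * Nw x))).
    by rewrite mulrCA ler_pM2l// -ler_pdivrMr// N_gt0.
  rewrite ler_pM2l ?sc_gt0//; apply: le_trans (cN_le_m Mx) _.
  exact: m_le_w.
rewrite /u ler_pdivlMr//; apply: (@le_trans _ _ (sc x * mw x)).
  rewrite -mulrA ler_pM2l ?sc_gt0// mulrC; apply: le_trans (cN_le_m Mx).
  by rewrite ler_pM2l// w_le_N.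
by rewrite -ler_pdivlMr// m_gt0.
Qed.

Let u_cont x : M x -> continuous (u^~ x).
Proof. by move=> Mx t; apply: cvgM; [exact: cvg_cst|exact: M_wcont]. Qed.

Let y t (x : J -> R) : R := hammerstein K1 F (u^~ x) (v^~ x) t.
(** This is [y(a) + d] with [d = max(0, s - y(a))]; it is at least [sc x], so the division in [S] is
    harmless. *)
Let z (x : J -> R) : R := Num.max (y a x) (sc x).

Let S (x : J -> R) (j : J) : R :=
  match j with
  | None => clamp01 (tau x + sc x - y a x)
  | Some (true, t) => (y t x + (z x - y a x)) / z x
  | Some (false, t) => hammerstein K2 G (u^~ x) (v^~ x) t
  end.


Let F_along x s : M x -> unitI s -> F (s, u s x, v s x) <= FB.
Proof.
move=> Mx sI; apply: F_le; split; first split=> //=.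
  by rewrite in_itv/=; exact: u_bnd.
by rewrite /= in_itv/=; have /andP[h ->] := M_v s Mx; rewrite (le_trans (ltW alpha_gt0)).
Qed.

Let G_along x s : M x -> unitI s -> G (s, u s x, v s x) <= GB.
Proof.
move=> Mx sI; apply: G_le; split; first split=> //=.
  by rewrite in_itv/=; exact: u_bnd.
by rewrite /= in_itv/=; have /andP[h ->] := M_v s Mx; rewrite (le_trans (ltW alpha_gt0)).
Qed.

Let y_ge0 x t : 0 <= y t x.
Proof. exact: hammerstein_ge0. Qed.

Let y_le x t : M x -> y t x <= B1 * FB.
Proof.
move=> Mx; apply: hammerstein_le => //; [exact: u_cont|exact: M_vcont|].
by move=> s sI; apply: ler_pM => //; exact: F_along.
Qed.

Let y_cone x t t' : M x -> t \in `[a, b] -> c1 * y t' x <= y t x.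
Proof.
move=> Mx tab; apply: hammerstein_cone => //; [exact: u_cont|exact: M_vcont|].
by move=> s _; exact: K1_cone.
Qed.

Let z_ge_sc x : sc x <= z x.
Proof. by rewrite /z le_max lexx orbT. Qed.

Let z_ge_ya x : y a x <= z x.
Proof. by rewrite /z le_max lexx. Qed.

Let z_min x : M x -> smin <= z x.
Proof. by move=> Mx; apply: le_trans (sc_min Mx) (z_ge_sc x). Qed.

Let z_gt0 x : M x -> 0 < z x.
Proof. by move=> /z_min; exact: lt_le_trans. Qed.

(** The added constant [z x - y a x] is nonnegative, so the cone inequality survives because
    [c1 <= 1]. It cancels in differences, so the modulus of [y] is merely divided by [z x >= smin].
    The bounds on the second component are [G_bnd], applicable by [u_shell]. *)
Let SM x : M x -> M (S x).
Proof.
move=> Mx; have z0 := z_gt0 Mx; apply: M_intro; rewrite /tau /w /v /S.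
- by have := clamp01_unitI (tau x + sc x - y a x); rewrite /unitI/= in_itv.
- by rewrite addrCA subrr addr0 divff// gt_eqF.
- by move=> t; rewrite divr_ge0 ?(ltW z0)// addr_ge0// subr_ge0.
- move=> t t' tab; rewrite mulrA ler_pM2r ?invr_gt0// mulrDr lerD ?y_cone//.
  by rewrite ler_piMl// subr_ge0.
- move=> t t' e te; rewrite -mulrBl /Lw mulrAC.
  have yy : `|y t x - y t' x| <= FB * e.
    by apply: hammerstein_modulus => //; [exact: u_cont|exact: M_vcont|
      move=> s; exact: F_along].
  have -> : y t x + (z x - y a x) - (y t' x + (z x - y a x)) = y t x - y t' x by ring.
  apply: (@le_trans _ _ (FB * e / z x)).
    by rewrite ler_pM2r ?invr_gt0//; apply: le_trans (ler_norm _) yy.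
  apply: ler_wpM2l; first exact: le_trans yy.
  by rewrite lef_pV2 ?posrE// z_min.
- by move=> t; apply: G_bnd; [exact: u_cont|exact: M_vcont|exact: u_shell|
    move=> s; exact: M_v].
move=> t t' e te; apply: le_trans (ler_norm _) _.
by apply: hammerstein_modulus => //; [exact: u_cont|exact: M_vcont|
  move=> s; exact: G_along].
Qed.

Let w_unif : unif_family M w. Proof. exact: unif_family_coord. Qed.

Let v_unif : unif_family M v. Proof. exact: unif_family_coord. Qed.

Let w_norm x t : M x -> `|w t x| <= c1^-1.
Proof. by move=> Mx; rewrite ger0_norm ?w_le ?M_w0. Qed.

Let sc_unif : unif_family M (fun (_ : R) x => sc x).
Proof.
have tau_unif : unif_family M (fun (_ : R) x => tau x) by exact: unif_family_coord.
have tau_norm x : M x -> `|tau x| <= 1.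
  by move=> /M_tau/andP[? ?]; rewrite ger0_norm.
have Nw_unif : unif_family M (fun (_ : R) x => Nw x).
  exact: (unif_family_max_on _ I0 w_unif w_norm).
have mw_unif : unif_family M (fun (_ : R) x => mw x).
  exact: (unif_family_min_on _ ab0 w_unif w_norm).
apply: unif_familyD.
  (* The product rule takes one bound for both factors; here and below it is the sum of the separate
     bounds. *)
  apply: (@unif_familyM _ _ _ _ (1 + rho2)) => [x t Mx|x t Mx||].
  - have /andP[t0 t1] := M_tau Mx; rewrite ger0_norm ?subr_ge0//.
    by move: rho2_gt0; lra.
  - rewrite ger0_norm; last by rewrite divr_ge0 ?(ltW (N_gt0 Mx))// ltW.
    apply: (@le_trans _ _ rho2); last by lra.
    by rewrite ler_pdivrMr ?N_gt0// ler_peMr ?N_ge1// ltW.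
  - by apply: unif_familyD; [exact: unif_family_cst|exact: unif_familyN].
  apply: (@unif_familyM _ _ _ _ (1 + rho2)) => [x t Mx|x t Mx||].
  - by rewrite gtr0_norm//; lra.
  - rewrite gtr0_norm ?invr_gt0 ?N_gt0//.
    apply: (@le_trans _ _ 1); last by move: rho2_gt0; lra.
    by rewrite invf_le1 ?N_gt0// N_ge1.
  - exact: unif_family_cst.
  by apply: (@unif_familyV _ _ _ _ 1) => // x t; exact: N_ge1.
have m_inv x : M x -> (mw x)^-1 <= c1^-1.
  by move=> Mx; rewrite lef_pV2 ?posrE ?m_gt0// c_le_m.
have c1V0 : 0 < c1^-1 by rewrite invr_gt0.
apply: (@unif_familyM _ _ _ _ (1 + rho1 / c1)) => [x t Mx|x t Mx||].
- by apply: (le_trans (tau_norm x Mx)); rewrite lerDl divr_ge0// ltW.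
- rewrite ger0_norm; last by rewrite divr_ge0 ?(ltW (m_gt0 Mx))// ltW.
  apply: (@le_trans _ _ (rho1 / c1)); last by lra.
  by rewrite ler_pM2l// m_inv.
- exact: tau_unif.
apply: (@unif_familyM _ _ _ _ (rho1 + c1^-1)) => [x t Mx|x t Mx||].
- by rewrite gtr0_norm//; lra.
- rewrite gtr0_norm ?invr_gt0 ?m_gt0//; apply: (le_trans (m_inv x Mx)).
  by move: rho1_gt0; lra.
- exact: unif_family_cst.
by apply: (@unif_familyV _ _ _ _ c1) => // x t; exact: c_le_m.
Qed.

Let u_unif : unif_family M u.
Proof.
apply: (@unif_familyM _ _ _ _ (smax + c1^-1)) => [x t Mx|x t Mx||//].
- rewrite gtr0_norm ?sc_gt0// (le_trans (sc_max Mx))// lerDl invr_ge0.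
  exact: ltW.
- by apply: le_trans (w_norm t Mx) _; rewrite lerDr ltW.
exact: sc_unif.
Qed.

Let v_bnd x s : M x -> 0 <= v s x <= beta.
Proof. by move=> /(M_v s)/andP[h ->]; rewrite (le_trans (ltW alpha_gt0)). Qed.

Let y_unif : unif_family M y.
Proof.
apply: (unif_family_hammerstein (K := B1) (U := Umax) (V := beta)).
- exact: cK1.
- exact: cF.
- by move=> t s; rewrite ger0_norm.
- exact: u_cont.
- exact: M_vcont.
- by move=> x s; exact: u_bnd.
- by move=> x s; exact: v_bnd.
- exact: u_unif.
- exact: v_unif.
Qed.

Let S_unif : unif_family M (fun j x => S x j).
Proof.
have ya_unif : unif_family M (fun (_ : R) x => y a x).
  exact: (unif_family_reindex (fun _ => a) y_unif).
have z_unif : unif_family M (fun (_ : R) x => z x).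
  exact: unif_family_max ya_unif sc_unif.
have tau'_unif : unif_family M (fun (_ : R) x => S x None).
  apply: unif_family_clamp01; apply: unif_familyD; last exact: unif_familyN.
  by apply: unif_familyD => //; exact: unif_family_coord.
have w'_unif : unif_family M (fun t x => S x (Some (true, t))).
  apply: (@unif_familyM _ _ _ _ (B1 * FB + (B1 * FB + smax) + smin^-1)).
  - move=> x t Mx; have yt := y_le t Mx; have yt0 := y_ge0 x t.
    have z0 : z x <= B1 * FB + smax.
      rewrite /z ge_max (le_trans (y_le a Mx)) ?lerDl ?(ltW smax_gt0)//=.
      by apply: le_trans (sc_max Mx) _; rewrite lerDr mulr_ge0.
    have smV : 0 < smin^-1 by rewrite invr_gt0.
    have zy : 0 <= z x - y a x by rewrite subr_ge0.
    have ya0 := y_ge0 x a.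
    rewrite ger0_norm; last exact: addr_ge0.
    by lra.
  - move=> x t Mx; rewrite gtr0_norm ?invr_gt0 ?z_gt0//.
    apply: (@le_trans _ _ smin^-1); first by rewrite lef_pV2 ?posrE ?z_gt0// z_min.
    by rewrite lerDr addr_ge0 ?addr_ge0 ?mulr_ge0// ltW.
  - apply: unif_familyD => //; apply: unif_familyD => //; exact: unif_familyN.
  by apply: (@unif_familyV _ _ _ _ smin) => // x t; exact: z_min.
have v'_unif : unif_family M (fun t x => S x (Some (false, t))).
  apply: (unif_family_hammerstein (K := B2) (U := Umax) (V := beta)).
  - exact: cK2.
  - exact: cG.
  - by move=> t s; rewrite ger0_norm.
  - exact: u_cont.
  - exact: M_vcont.
  - by move=> x s; exact: u_bnd.
  - by move=> x s; exact: v_bnd.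
  - exact: u_unif.
  - exact: v_unif.
move=> e e0; have [d d0 dS] := tau'_unif e e0.
have [d' d'0 d'S] := unif_family2 w'_unif v'_unif e0 e0
  (fun x y t _ _ h1 h2 => conj h1 h2).
exists (Num.min d d'); first by rewrite lt_min d0 d'0.
move=> x y' Mx My xy.
have xyd : uclose d x y' by move=> i; rewrite (le_trans (xy i))// ge_min lexx.
have xyd' : uclose d' x y' by move=> i; rewrite (le_trans (xy i))// ge_min lexx orbT.
move=> [[[] t]|]; [exact: (d'S _ _ Mx My xyd' t).1|exact: (d'S _ _ Mx My xyd' t).2|].
exact: (dS _ _ Mx My xyd 0).
Qed.

Let M_neq0 : M !=set0.
Proof.
exists (fun j => match j with
  | None => 0 | Some (true, _) => 1 | Some (false, _) => alpha end).
apply: M_intro; rewrite /tau /w /v.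
- by rewrite lexx ler01.
- by [].
- by move=> _; exact: ler01.
- by move=> t t' _; rewrite mulr1.
- by move=> t t' e te; rewrite subrr mulr_ge0// (le_trans _ (te 0)).
- by move=> _; rewrite lexx ltW.
- by move=> t t' e te; rewrite subrr mulr_ge0// (le_trans _ (te 0)).
Qed.

Let M_bnd x j : M x -> `|x j| <= 1 + c1^-1 + beta.
Proof.
have c1V0 : 0 < c1^-1 by rewrite invr_gt0.
move=> Mx; case: j => [[[] t]|].
- have := w_norm t Mx; rewrite /w; move: alpha_gt0 alpha_lt_beta; lra.
- have /andP[? ?] := M_v t Mx; rewrite ger0_norm -/(v t x).
    by lra.
  by move: alpha_gt0; lra.
have /andP[? ?] := M_tau Mx; rewrite ger0_norm -/(tau x)//.
by move: alpha_gt0 alpha_lt_beta; lra.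
Qed.

Let M_equi (e : R) : 0 < e -> exists s : seq J, exists2 d : R, 0 < d &
  forall x y, M x -> M y -> (forall j, j \in s -> `|x j - y j| <= d) -> uclose e x y.
Proof.
move=> e0.
have [s1 s1P] := kernel_modulus_equi cK1 K1_clampl K1_clampr Lw_ge0 e0.
have [s2 s2P] := kernel_modulus_equi cK2 K2_clampl K2_clampr GB_ge0 e0.
exists (None :: [seq Some (true, t) | t <- s1] ++ [seq Some (false, t) | t <- s2]).
exists (e / 3); first by rewrite divr_gt0.
move=> x y' Mx My xy [[[] t]|].
- apply: (s1P _ _ (M_wmod Mx) (M_wmod My)) => t' t's; apply: xy.
  by rewrite inE mem_cat map_f// orbT.
- apply: (s2P _ _ (M_vmod Mx) (M_vmod My)) => t' t's; apply: xy.
  by rewrite inE mem_cat (map_f (fun t => Some (false, t)))// !orbT.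
apply: le_trans (xy None _) _; first by rewrite inE.
by rewrite ler_pdivrMr// ler_pMr//; lra.
Qed.

Let fixed_point_scale x : M x -> (forall j, S x j = x j) -> y a x = sc x.
Proof.
move=> Mx Sx.
have sc0 := sc_gt0 Mx; have z0 := z_gt0 Mx.
have Sw t : y t x + (z x - y a x) = w t x * z x.
  by rewrite -[w t x](Sx (Some (true, t))) divfK// gt_eqF.
have Stau : clamp01 (tau x + sc x - y a x) = tau x := Sx None.
have /andP[tau0 tau1] := M_tau Mx.
have N0 := N_gt0 Mx; have m0 := m_gt0 Mx.
apply/eqP; rewrite eq_le; apply/andP; split; rewrite leNgt; apply/negP => lt.
  (* Case [sc x < y a x]: the clamp returns [tau x] although its argument is smaller, which forces
     [tau x = 0]. *)
  have zE : z x = y a x by rewrite /z (max_idPl (ltW lt)).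
  have t0 : tau x = 0.
    move: Stau; rewrite /clamp01; case: (leP _ 1) => ?; last lra.
    by case: (leP 0 _) => ?; lra.
  have scE : sc x = rho2 / Nw x by rewrite /sc t0 subr0 mul1r mul0r addr0.
  have ya0 : 0 < y a x by rewrite -zE.
  have y2 t : y t x <= rho2.
    apply: F_upper; [exact: u_cont|exact: M_vcont| |by move=> s; exact: M_v].
    move=> s; have /andP[-> _] := u_bnd s Mx.
    by rewrite /u scE mulrAC ler_pdivrMr// ler_pM2l// w_le_N.
  (* Here [w = y / y(a)], whereas [sc x = rho2 / Nw x < y a x] makes [Nw x] larger than this
     quotient. *)
  have : Nw x <= rho2 / y a x.
    apply: max_on_le => // t _; rewrite ler_pdivlMr//.
    by rewrite -{1}zE -Sw zE subrr addr0.
  by rewrite ler_pdivlMr// mulrC -ler_pdivlMr// -scE leNgt lt.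
(* Case [y a x < sc x]: by the same reasoning the clamp forces [tau x = 1]. *)
have zE : z x = sc x by rewrite /z (max_idPr (ltW lt)).
have t1 : tau x = 1.
  move: Stau; rewrite /clamp01; case: (leP _ 1) => ?; last by rewrite (max_r ler01).
  by case: (leP 0 _) => ?; lra.
have scE : sc x = rho1 / mw x by rewrite /sc t1 subrr mul0r add0r mul1r.
have y1 t : t \in `[a, b] -> rho1 <= y t x.
  apply: F_lower; [exact: u_cont|exact: M_vcont| |by move=> s; exact: M_v].
  move=> s sab; rewrite /u scE; apply/andP; split.
    by rewrite mulrAC ler_pdivlMr// ler_pM2l// m_le_w.
  rewrite -mulrA ler_pM2l// mulrC ler_pdivrMr//.
  rewrite mulrC ler_pdivlMr// mulrC; apply: le_trans (cN_le_m Mx).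
  by rewrite ler_pM2l// w_le_N.
(* Here [sc x * w] is [y] plus a positive constant, so its minimum exceeds [rho1], whereas
   [sc x * mw x = rho1]. *)
have : (rho1 + (sc x - y a x)) / sc x <= mw x.
  apply: min_on_ge => // t tab; rewrite ler_pdivrMr// -{2}zE -Sw zE lerD2r.
  exact: y1.
rewrite ler_pdivrMr// {2}scE mulrCA divff ?gt_eqF// mulr1; lra.
Qed.

(** Since [y a x = sc x] at the fixed point, also [z x = sc x], and the equation for [w] becomes
    [y = sc x * w], that is [y = u]. Positivity at [a] comes from [w a x = 1], and the last bounds
    are those on [sc x * Nw x] and [sc x * mw x] in Case B. *)
Theorem exists_fixed_point_in_shell : exists U V : R -> R,
  [/\ continuous U /\ continuous V,
      (forall t, U t = hammerstein K1 F U V t) /\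
        (forall t, V t = hammerstein K2 G U V t),
      0 < U a /\ in_shell U,
      forall t, alpha <= V t <= beta &
      rho2 < rho1 -> rho2 <= max_on (@unitI R) U /\ min_on `[a, b] U <= rho1].
Proof.
have [x Mx Sx] := schauder_fixed_point M_neq0 (closed_halfspaces (A := _))
  (convex_halfspaces (A := _)) M_bnd M_equi SM S_unif.
have sc0 := sc_gt0 Mx.
have yaE := fixed_point_scale Mx Sx.
have zE : z x = sc x by rewrite /z yaE maxxx.
have uE t : u t x = y t x.
  have : S x (Some (true, t)) = w t x := Sx _.
  rewrite /S zE yaE subrr addr0 /u => <-.
  by rewrite mulrC divfK// gt_eqF.
exists (u^~ x), (v^~ x); split.
- by split; [exact: u_cont|exact: M_vcont].
- by split=> t; [exact: uE|exact/esym/(Sx (Some (false, t)))].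
- by split; [rewrite /u M_wa// mulr1|exact: u_shell].
- by move=> t; exact: M_v.
move=> cB; have /andP[s2 s1] := scales_caseB cB Mx.
rewrite ler_pdivrMr ?N_gt0// in s2; rewrite ler_pdivlMr ?m_gt0// in s1.
split.
  apply: le_trans s2 _; rewrite mulrC -ler_pdivlMr//.
  apply: max_on_le => // s sI; rewrite ler_pdivlMr// mulrC.
  apply: (@max_on_ge _ _ (u^~ x) Umax) => // s' _.
  by have /andP[] := u_bnd s' Mx.
apply: le_trans s1; rewrite mulrC -ler_pdivrMr//.
apply: min_on_ge => // s sab; rewrite ler_pdivrMr// mulrC.
apply: (@min_on_le _ _ (u^~ x) 0) => // s' _.
by have /andP[] := u_bnd s' Mx.
Qed.

End Shell.

(** * Extension of the data from the unit interval to the whole line *)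

Section Globalization.
Variables (R : realType) (k : R * R -> R).
Hypothesis hk : continuous_nneg_on (@unitI R `*` @unitI R) k.
Local Notation mu := (@lebesgue_measure R).

Let K := k \o @clamp_square R.

Lemma clamped_kernel_continuous : continuous K.
Proof.
by apply: continuous_comp_within hk.1; [exact: continuous_clamp_square|
  exact: clamp_square_unitI].
Qed.

Lemma clamped_kernel_ge0 z : 0 <= K z.
Proof. by apply: hk.2; exact: clamp_square_unitI. Qed.

Lemma clamped_kernel_clampl t s : K (t, s) = K (clamp01 t, s).
Proof.
by rewrite /K /clamp_square/= (clamp01_id (clamp01_unitI t)).
Qed.

Lemma clamped_kernel_clampr t s : K (t, s) = K (t, clamp01 s).
Proof.
by rewrite /K /clamp_square/= (clamp01_id (clamp01_unitI s)).
Qed.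

Lemma clamped_kernel_id t s : unitI t -> unitI s -> K (t, s) = k (t, s).
Proof. by move=> tI sI; rewrite /K /clamp_square/= !clamp01_id. Qed.

Lemma clamped_kernel_bounded :
  exists2 B : R, 0 <= B & forall t s, K (t, s) <= B.
Proof.
have I0 : (@unitI R `*` @unitI R) !=set0.
  by exists (0, 0); split; rewrite /unitI/= in_itv/= lexx ler01.
have cI : compact (@unitI R `*` @unitI R : set (R * R)).
  by apply: compact_setX; exact: segment_compact.
have [B B0 KB] := compact_upper_bound I0 cI clamped_kernel_continuous.
exists B => // t s; rewrite clamped_kernel_clampl clamped_kernel_clampr.
by apply: KB; split; exact: clamp01_unitI.
Qed.

Lemma hammerstein_clamp f u v t :
  hammerstein K f u v t = hammerstein K f u v (clamp01 t).
Proof. by apply: eq_Rintegral => s _; rewrite clamped_kernel_clampl. Qed.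

Variable h : R -> R.
Hypothesis hh : continuous_nneg_on (@unitI R) h.

Let H := h \o @clamp01 R.

Lemma clamped_continuous : continuous H.
Proof.
by apply: continuous_comp_within hh.1; [exact: continuous_clamp01|
  exact: clamp01_unitI].
Qed.

Lemma clamped_ge0 s : 0 <= H s.
Proof. by apply: hh.2; exact: clamp01_unitI. Qed.

Lemma clamped_integralE (D : set R) t : D `<=` @unitI R -> unitI t ->
  \int[mu]_(s in D) (k (t, s) * h s) = \int[mu]_(s in D) (K (t, s) * H s).
Proof.
move=> DI tI; apply: eq_Rintegral => s /set_mem/DI sI.
by rewrite clamped_kernel_id// /H/= clamp01_id.
Qed.

Lemma clamped_integral_le rho t : unitI t ->
  max_on (@unitI R) (fun t => \int[mu]_(s in @unitI R) (k (t, s) * h s)) <= rho ->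
  \int[mu]_(s in @unitI R) (K (t, s) * H s) <= rho.
Proof.
move=> tI; apply: le_trans; rewrite -clamped_integralE//.
have [B B0 KB] := clamped_kernel_bounded.
have I0 : @unitI R !=set0 by exists t.
have [C C0 HC] := compact_upper_bound I0 (@segment_compact R 0 1) clamped_continuous.
(* The bound [B * C] makes the supremum in [max_on] a genuine one. *)
apply: (@max_on_ge _ _ (fun t => \int[mu]_(s in @unitI R) (k (t, s) * h s)) (B * C)) => //.
move=> s sI; rewrite clamped_integralE//.
have cH : continuous (fun z : R * R * R => H z.1.1).
  move=> z; apply: (continuous_comp (f := fun z : R * R * R => z.1.1) (g := H));
    last exact: clamped_continuous.
  by apply: (continuous_comp (f := fst) (g := fst)); exact: cvg_fst.
have c0 : continuous (fun _ : R => 0 : R) by move=> ?; exact: cvg_cst.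
(* The integral is read as a Hammerstein operator whose nonlinearity depends on [s] alone, applied
   to zero functions. *)
apply: (@hammerstein_le _ K (fun z => H z.1.1) clamped_kernel_continuous cH
  _ _ c0 c0 _ _ clamped_kernel_ge0) => [z|s' s'I].
  exact: clamped_ge0.
by apply: ler_pM; [exact: clamped_kernel_ge0|exact: clamped_ge0|exact: KB|exact: HC].
Qed.

Lemma clamped_integral_ge (D E : set R) rho t : D `<=` @unitI R -> E `<=` @unitI R -> D t ->
  rho <= min_on D (fun t => \int[mu]_(s in E) (k (t, s) * h s)) ->
  rho <= \int[mu]_(s in E) (K (t, s) * H s).
Proof.
move=> DI EI Dt hrho; apply: (le_trans hrho).
rewrite -clamped_integralE//; last exact: DI.
apply: (@min_on_le _ _ (fun t => \int[mu]_(s in E) (k (t, s) * h s)) 0) => // s Ds.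
apply: Rintegral_ge0 => s' Es'; apply: mulr_ge0.
  by apply: hk.2; split; [exact: DI|exact: EI].
by apply: hh.2; exact: EI.
Qed.

End Globalization.

Lemma clamp_box_id (R : realType) (s x y : R) : unitI s -> 0 <= x -> 0 <= y ->
  clamp_box (s, x, y) = (s, x, y).
Proof. by move=> sI x0 y0; rewrite /clamp_box/= clamp01_id// !max_r. Qed.

Lemma clamped_nonlinearity_continuous (R : realType) (f : R * R * R -> R) :
  continuous_nneg_on (@unitI R `*` @Rplus R `*` @Rplus R) f ->
  continuous (f \o @clamp_box R) /\ forall z, 0 <= f (clamp_box z).
Proof.
move=> hf; split; last by move=> z; apply: hf.2; exact: clamp_box_in.
by apply: continuous_comp_within hf.1; [exact: continuous_clamp_box|exact: clamp_box_in].
Qed.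

(** * Transfer from the clamped problem to the system on the unit interval *)

Theorem theorem3p1 (R : realType) (k1 k2 : R * R -> R) (f g : R * R * R -> R)
  (a b c1 c2 : R) (Phi1 Phi2 : R -> R) (rho1 rho2 alpha beta : R)
  (hk1 : continuous_nneg_on (@unitI R `*` @unitI R) k1)
  (hk2 : continuous_nneg_on (@unitI R `*` @unitI R) k2)
  (hab : a <= b) (habI : `[a, b] `<=` @unitI R)
  (hPhi1_ge0 : forall s, unitI s -> 0 <= Phi1 s)
  (hPhi1_L1 : (@lebesgue_measure R).-integrable (@unitI R) (EFin \o Phi1))
  (hc1 : 0 < c1 <= 1)
  (hk1_le : forall t s, unitI t -> unitI s -> k1 (t, s) <= Phi1 s)
  (hk1_ge : forall t s, t \in `[a, b] -> unitI s -> c1 * Phi1 s <= k1 (t, s))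
  (hPhi2_ge0 : forall s, unitI s -> 0 <= Phi2 s)
  (hPhi2_L1 : (@lebesgue_measure R).-integrable (@unitI R) (EFin \o Phi2))
  (hc2 : 0 < c2 <= 1)
  (hk2_bnd : forall t s, unitI t -> unitI s ->
     c2 * Phi2 s <= k2 (t, s) <= Phi2 s)
  (hf : continuous_nneg_on (@unitI R `*` @Rplus R `*` @Rplus R) f)
  (hg : continuous_nneg_on (@unitI R `*` @Rplus R `*` @Rplus R) g)
  (hrho1 : 0 < rho1) (hrho2 : 0 < rho2)
  (halpha : 0 < alpha) (hbeta : alpha < beta)
  (hcase : rho1 / c1 < rho2 \/ rho2 < rho1)
  (hi : exists f_lo : R -> R,
     [/\ continuous_nneg_on (@unitI R) f_lo,
         forall t x y, t \in `[a, b] -> x \in `[rho1, rho1 / c1] ->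
           y \in `[alpha, beta] -> f_lo t <= f (t, x, y) &
         rho1 <= min_on `[a, b] (fun t =>
           \int[@lebesgue_measure R]_(s in `[a, b]) (k1 (t, s) * f_lo s))])
  (hii : exists f_hi : R -> R,
     [/\ continuous_nneg_on (@unitI R) f_hi,
         forall t x y, t \in `[0, 1] -> x \in `[0, rho2] ->
           y \in `[alpha, beta] -> f (t, x, y) <= f_hi t &
         max_on (@unitI R) (fun t =>
           \int[@lebesgue_measure R]_(s in @unitI R) (k1 (t, s) * f_hi s))
         <= rho2])
  (hiii : exists g_lo : R -> R,
     [/\ continuous_nneg_on (@unitI R) g_lo,
         rho1 / c1 < rho2 ->
           forall t x y, t \in `[a, b] -> x \in `[rho1, rho2] ->
             y \in `[alpha, beta] -> g_lo t <= g (t, x, y),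
         rho2 < rho1 ->
           forall t x y, t \in `[a, b] -> x \in `[c1 * rho2, rho1 / c1] ->
             y \in `[alpha, beta] -> g_lo t <= g (t, x, y) &
         alpha <= min_on (@unitI R) (fun t =>
           \int[@lebesgue_measure R]_(s in `[a, b]) (k2 (t, s) * g_lo s))])
  (hiv : exists g_hi : R -> R,
     [/\ continuous_nneg_on (@unitI R) g_hi,
         rho1 / c1 < rho2 ->
           forall t x y, t \in `[0, 1] -> x \in `[0, rho2] ->
             y \in `[alpha, beta] -> g (t, x, y) <= g_hi t,
         rho2 < rho1 ->
           forall t x y, t \in `[0, 1] -> x \in `[0, rho1 / c1] ->
             y \in `[alpha, beta] -> g (t, x, y) <= g_hi t &
         max_on (@unitI R) (fun t =>
           \int[@lebesgue_measure R]_(s in @unitI R) (k2 (t, s) * g_hi s))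
         <= beta]) :
  exists u v : R -> R,
    [/\ positive_solution a b c1 c2 k1 k2 f g u v,
        forall t, unitI t -> alpha <= v t <= beta,
        rho1 / c1 < rho2 ->
          rho1 <= min_on `[a, b] u /\ norm_oo u <= rho2 &
        rho2 < rho1 ->
          rho2 <= norm_oo u /\ min_on `[a, b] u <= rho1].
Proof.
have /andP[c1_gt0 c1_le1] := hc1; have /andP[c2_gt0 _] := hc2.
pose K1 := k1 \o @clamp_square R; pose K2 := k2 \o @clamp_square R.
pose F := f \o @clamp_box R; pose G := g \o @clamp_box R.
have [cF F0] := clamped_nonlinearity_continuous hf.
have [cG G0] := clamped_nonlinearity_continuous hg.
have [B1 B1_ge0 K1_le] := clamped_kernel_bounded hk1.
have [B2 B2_ge0 K2_le] := clamped_kernel_bounded hk2.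
(* Both sides are compared with [c1 * Phi1] at the clamped point; [K2_cone] uses [Phi2] likewise. *)
have K1_cone t t' s : t \in `[a, b] -> c1 * K1 (t', s) <= K1 (t, s).
  move=> tab; rewrite /K1/= /clamp_square/= (clamp01_id (habI _ tab)).
  apply: le_trans (hk1_ge _ _ tab (clamp01_unitI s)).
  by rewrite ler_pM2l// hk1_le//; exact: clamp01_unitI.
have K2_cone t t' s : c2 * K2 (t', s) <= K2 (t, s).
  have /andP[_ h1] := hk2_bnd _ _ (clamp01_unitI t') (clamp01_unitI s).
  have /andP[h2 _] := hk2_bnd _ _ (clamp01_unitI t) (clamp01_unitI s).
  by apply: le_trans h2; rewrite ler_pM2l.
pose Umax := Num.max rho2 (rho1 / c1) / c1.
have Umax_ge0 : 0 <= Umax by rewrite divr_ge0 ?le_max ?(ltW hrho2)// ltW.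
have box0 : (@unitI R `*` `[0, Umax] `*` `[0, beta]) !=set0.
  exists (0, 0, 0); split; first split; rewrite /unitI/= in_itv/= ?lexx ?ler01//.
  by rewrite ltW// (lt_trans halpha).
have [FB FB_ge0 F_le] := compact_upper_bound box0 (@compact_box R _ _) cF.
have [GB GB_ge0 G_le] := compact_upper_bound box0 (@compact_box R _ _) cG.
have FE s x y : unitI s -> 0 <= x -> 0 <= y -> F (s, x, y) = f (s, x, y).
  by move=> sI x0 y0; rewrite /F/= clamp_box_id.
have GE s x y : unitI s -> 0 <= x -> 0 <= y -> G (s, x, y) = g (s, x, y).
  by move=> sI x0 y0; rewrite /G/= clamp_box_id.
have cK1 := clamped_kernel_continuous hk1.
have cK2 := clamped_kernel_continuous hk2.
have K1_ge0 := clamped_kernel_ge0 hk1.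
have K2_ge0 := clamped_kernel_ge0 hk2.
have F_lower (u v : R -> R) : continuous u -> continuous v ->
    (forall s, s \in `[a, b] -> rho1 <= u s <= rho1 / c1) ->
    (forall s, alpha <= v s <= beta) ->
    forall t, t \in `[a, b] -> rho1 <= hammerstein K1 F u v t.
  move=> cu cv hu hv t tab; have [f_lo [hf_lo f_lo_le int_lo]] := hi.
  have cf_lo := clamped_continuous hf_lo.
  apply: le_trans (clamped_integral_ge hk1 hf_lo habI habI tab int_lo) _.
  apply: hammerstein_lower => // s sab; have sI := habI _ sab.
  have /andP[u1 u2] := hu s sab; have /andP[v1 v2] := hv s.
  rewrite FE//= ?clamp01_id//; [|exact: le_trans (ltW hrho1) u1|
    exact: le_trans (ltW halpha) v1].
  by apply: f_lo_le => //; rewrite in_itv/= ?u1 ?v1.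
have F_upper (u v : R -> R) : continuous u -> continuous v ->
    (forall s, 0 <= u s <= rho2) -> (forall s, alpha <= v s <= beta) ->
    forall t, hammerstein K1 F u v t <= rho2.
  move=> cu cv hu hv t; have [f_hi [hf_hi f_hi_ge int_hi]] := hii.
  have cf_hi := clamped_continuous hf_hi.
  rewrite (hammerstein_clamp k1).
  apply: le_trans (clamped_integral_le hk1 hf_hi (clamp01_unitI t) int_hi).
  apply: hammerstein_upper => // s sI.
  have /andP[u1 u2] := hu s; have /andP[v1 v2] := hv s.
  rewrite FE//= ?clamp01_id//; last exact: le_trans (ltW halpha) v1.
  by apply: f_hi_ge => //; rewrite in_itv/= ?u1 ?v1.
have G_bnd (u v : R -> R) : continuous u -> continuous v ->
    in_shell a b c1 rho1 rho2 u -> (forall s, alpha <= v s <= beta) ->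
    forall t, alpha <= hammerstein K2 G u v t <= beta.
  move=> cu cv [u0 uA uB] hv t; rewrite (hammerstein_clamp k2).
  have [g_lo [hg_lo g_loA g_loB int_lo]] := hiii.
  have [g_hi [hg_hi g_hiA g_hiB int_hi]] := hiv.
  have tI := clamp01_unitI t; apply/andP; split.
    have cg_lo := clamped_continuous hg_lo.
    apply: le_trans (clamped_integral_ge hk2 hg_lo (fun _ h => h) habI tI int_lo) _.
    apply: hammerstein_lower => // s sab; have sI := habI _ sab.
    have /andP[v1 v2] := hv s.
    rewrite GE//= ?clamp01_id//; last exact: le_trans (ltW halpha) v1.
    (* In either case the shell confines [u] to the range where [g_lo] bounds [g] from below. *)
    case: hcase => hc.
      have [u1 u2] := uA hc.
      by apply: g_loA => //; rewrite in_itv/= ?v1// u1// u2.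
    have [u1 u2] := uB hc.
    by apply: g_loB => //; rewrite in_itv/= ?v1// u1// u2.
  have cg_hi := clamped_continuous hg_hi.
  apply: le_trans (clamped_integral_le hk2 hg_hi tI int_hi).
  apply: hammerstein_upper => // s sI.
  have /andP[v1 v2] := hv s.
  rewrite GE//= ?clamp01_id//; last exact: le_trans (ltW halpha) v1.
  case: hcase => hc.
    have [_ u2] := uA hc.
    by apply: g_hiA => //; rewrite in_itv/= ?v1// u0 u2.
  have [_ u2] := uB hc.
  by apply: g_hiB => //; rewrite in_itv/= ?v1// u0 u2.
have [U [V [[cU cV] [UE VE] [Ua [U0 UA UB]] Vab caseB]]] :=
  exists_fixed_point_in_shell cK1 cK2 cF cG K1_ge0 K2_ge0 F0 G0
    (clamped_kernel_clampl k1) (clamped_kernel_clampr k1)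
    (clamped_kernel_clampl k2) (clamped_kernel_clampr k2)
    B1_ge0 K1_le K2_le hab habI c1_gt0 c1_le1 K1_cone hrho1 hrho2 halpha hbeta
    FB_ge0 GB_ge0 F_le G_le F_lower F_upper G_bnd.
have V0 s : 0 <= V s by have /andP[h _] := Vab s; exact: le_trans (ltW halpha) h.
have I0 : @unitI R !=set0 by exists 0; rewrite /unitI/= in_itv/= lexx ler01.
have ab0 : [set` `[a, b]] !=set0 by exists a; rewrite /= in_itv/= lexx.
have aI : unitI a by apply: habI; rewrite /= in_itv/= lexx.
(* [U] is in the range of the operator, so the comparison of kernels passes to it under the
   integral. *)
have coneU t s : t \in `[a, b] -> c1 * U s <= U t.
  move=> tab; rewrite [U s]UE [U t]UE.
  by apply: hammerstein_cone => // s' _; exact: K1_cone.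
have coneV t s : c2 * V s <= V t.
  rewrite [V s]VE [V t]VE.
  by apply: hammerstein_cone => // s' _; exact: K2_cone.
exists U, V; split.
- split.
  + split; split => /=.
    * exact: continuous_subspaceT.
    * by move=> t _; exact: U0.
    * apply: min_on_ge => // t tab; rewrite mulrC -ler_pdivlMr//.
      apply: max_on_le => // s _.
      by rewrite ger0_norm// ler_pdivlMr// mulrC; exact: coneU.
    * exact: continuous_subspaceT.
    * apply: min_on_ge => // t tI; rewrite mulrC -ler_pdivlMr//.
      apply: max_on_le => // s _.
      by rewrite ger0_norm// ler_pdivlMr// mulrC; exact: coneV.
  (* All clamps are the identity here, because [U] and [V] are nonnegative and [t], [s] lie in the
     unit interval. *)
  + move=> t tI; split.
      rewrite [U t]UE; apply: eq_Rintegral => s /set_mem sI.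
      by rewrite /= clamp_box_id// /clamp_square/= !clamp01_id.
    rewrite [V t]VE; apply: eq_Rintegral => s /set_mem sI.
    by rewrite /= clamp_box_id// /clamp_square/= !clamp01_id.
  + by split=> [t _|]; [exact: U0|exists a; rewrite ?gt_eqF].
  + split=> [t _|]; first exact: V0.
    exists a => //; rewrite gt_eqF//.
    by have /andP[h _] := Vab a; exact: lt_le_trans h.
- by move=> t _; exact: Vab.
- move=> hc; have [u1 u2] := UA hc; split; first exact: min_on_ge.
  by apply: max_on_le => // s _; rewrite ger0_norm.
move=> hc; have [nU mU] := caseB hc; split=> //.
apply: (le_trans nU); apply: max_on_le => // s sI.
rewrite -[leLHS]ger0_norm//.
have [_ u2] := UB hc.
by apply: (@max_on_ge _ _ (fun t => `|U t|) (rho1 / c1)) => // s' _; rewrite ger0_norm.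
Qed.
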